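(* The parameterized problem \textsc{Internal Vertex SubTree} on general (not necessarily connected) graphs does not have a polynomial kernel unless $\mathrm{NP}\subseteq\mathrm{coNP}/\mathrm{poly}$.
   Context: A subtree of a graph $G$ is a (not necessarily induced) subgraph of $G$ that is a tree; its internal vertices are its vertices of degree greater than $1$. \textsc{Internal Vertex SubTree}: given a graph $G$ and an integer $k$, decide whether $G$ contains a subtree with at least $k$ internal vertices (parameter $k$). A kernelization for a parameterized problem $L\subseteq\Sigma^*\times\mathbb{N}$ is a polynomial-time algorithm that maps $(x,k)$ to $(x',k')$ with $(x,k)\in L\iff(x',k')\in L$ and $|x'|,k'\le f(k)$ for a computable $f$; it is a polynomial kernel if $f$ is a polynomial. *)

(* Defs.v *)
From HB Require Import structures.
From mathcomp Require Import all_boot all_order all_algebra.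

Set Implicit Arguments.
Unset Strict Implicit.
Unset Printing Implicit Defensive.

Local Open Scope nat_scope.

(** * Deterministic multi-tape Turing machines *)

(* The tape alphabet is {0, 1, blank}, with [None] for the blank. *)
Notation word := (seq bool).
Notation symbol := (option bool).

Inductive direction := GoLeft | Stay | GoRight.

(* A two-way infinite tape: the scanned cell, the cells to its left (nearest
   first) and the cells to its right (nearest first); cells beyond the ends of
   the lists are blank. *)
Record tape := Tape {
  left_cells : seq symbol;
  scanned : symbol;
  right_cells : seq symbol
}.

Definition write_move (t : tape) (a : symbol) (d : direction) : tape :=
  let: Tape l _ r := t in
  match d with
  | GoLeft => Tape (behead l) (head None l) (a :: r)
  | Stay => Tape l a r
  | GoRight => Tape (a :: l) (head None r) (behead r)
  end.

Definition tape_of (w : word) : tape :=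
  let s := map Some w in Tape [::] (head None s) (behead s).

Fixpoint until_blank (s : seq symbol) : word :=
  if s is Some b :: s' then b :: until_blank s' else [::].

(* Tape [ord0] is both the input and the output tape. *)
Record machine := Machine {
  state : finType;
  extra_tapes : nat;
  start : state;
  halting : pred state;
  trans : state -> {ffun 'I_extra_tapes.+1 -> symbol} ->
          state * ('I_extra_tapes.+1 -> symbol * direction)
}.

Definition config (M : machine) : Type :=
  (state M * {ffun 'I_(extra_tapes M).+1 -> tape})%type.

Definition step (M : machine) (c : config M) : config M :=
  if halting c.1 then c else
  let qa := trans c.1 [ffun i => scanned (c.2 i)] in
  (qa.1, [ffun i => write_move (c.2 i) (qa.2 i).1 (qa.2 i).2]).

Definition init (M : machine) (w : word) : config M :=
  (start M, [ffun i => tape_of (if i == ord0 then w else [::])]).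

(* The output is the word that starts at the head and ends at the first
   blank. *)
Definition output (M : machine) (c : config M) : word :=
  let t := c.2 ord0 in until_blank (scanned t :: right_cells t).

Definition halts_within (M : machine) (w v : word) (t : nat) : Prop :=
  let c := iter t (@step M) (init M w) in halting c.1 /\ output c = v.

(** * Computable and polynomial-time functions, relative to encodings *)

Definition computable (A B : Type) (encA : A -> word) (encB : B -> word)
    (f : A -> B) : Prop :=
  exists M : machine, forall a : A, exists t : nat,
    halts_within M (encA a) (encB (f a)) t.

Definition polytime (A B : Type) (encA : A -> word) (encB : B -> word)
    (f : A -> B) : Prop :=
  exists (M : machine) (p : {poly nat}), forall a : A,
    halts_within M (encA a) (encB (f a)) (p.[size (encA a)])%R.

Definition enc_word (w : word) : word := w.
Definition enc_bool (b : bool) : word := [:: b].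
Definition unary (n : nat) : word := nseq n true.

(* Self-delimiting: 1^|x| 0 x y. *)
Definition pair_word (x y : word) : word := unary (size x) ++ false :: x ++ y.

(** * The classes NP and coNP/poly *)

Definition language := word -> Prop.
Definition complexity_class := language -> Prop.

Definition class_P : complexity_class := fun L =>
  exists chi : word -> bool,
    polytime enc_word enc_bool chi /\ (forall x, L x <-> chi x).

Definition class_NP : complexity_class := fun L =>
  exists (R : language) (p : {poly nat}), class_P R /\
    forall x, L x <->
      exists w : word, size w <= (p.[size x])%R /\ R (pair_word x w).

Definition class_co (C : complexity_class) : complexity_class := fun L =>
  C (fun x => ~ L x).

(* The advice depends on the length of the input only. *)
Definition class_poly (C : complexity_class) : complexity_class := fun L =>
  exists (L' : language) (advice : nat -> word) (p : {poly nat}),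
    [/\ C L',
        forall n, size (advice n) <= (p.[n])%R
      & forall x, L x <-> L' (pair_word x (advice (size x)))].

Definition class_incl (C D : complexity_class) : Prop := forall L, C L -> D L.

(** * Parameterized problems and kernelizations *)

Definition parameterized := word -> nat -> Prop.

(* The parameter is in unary, so that polynomial time in the length of the code
   is polynomial time in |x| + k. *)
Definition enc_instance (i : word * nat) : word := unary i.2 ++ false :: i.1.

Definition kernelization (L : parameterized) (K : word * nat -> word * nat)
    (f : nat -> nat) : Prop :=
  [/\ polytime enc_instance enc_instance K,
      computable unary unary f
    & forall x k, let: (x', k') := K (x, k) in
        [/\ L x k <-> L x' k', size x' <= f k & k' <= f k]].

Definition has_polynomial_kernel (L : parameterized) : Prop :=
  exists (K : word * nat -> word * nat) (f : nat -> nat),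
    kernelization L K f /\ exists p : {poly nat}, forall k, f k = (p.[k])%R.

(** * Graphs and subtrees *)

Record graph := Graph {
  order : nat;
  edge : rel 'I_order;
  edge_sym : symmetric edge;
  edge_irr : irreflexive edge
}.

(* The order in unary, then the adjacency matrix, row by row. *)
Definition enc_graph (G : graph) : word :=
  unary (order G) ++ false ::
  [seq @edge G i j | i <- enum 'I_(order G), j <- enum 'I_(order G)].

Record is_subgraph (G : graph) (V : {set 'I_(order G)})
    (F : rel 'I_(order G)) : Prop := IsSubgraph {
  subgraph_sym : symmetric F;
  subgraph_edge : subrel F (@edge G);
  subgraph_vertex : forall x y, F x y -> x \in V /\ y \in V
}.

(* [ucycle F c]: [c] lists without repetition the vertices of a closed walk of
   F; with at most two vertices it is empty or runs back and forth along a
   single edge. *)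
Record is_tree (T : finType) (V : {set T}) (F : rel T) : Prop := IsTree {
  tree_nonempty : V != set0;
  tree_connected : {in V &, forall x y, connect F x y};
  tree_acyclic : forall c : seq T, ucycle F c -> size c <= 2
}.

Definition degree (T : finType) (F : rel T) (x : T) : nat := #|[set y | F x y]|.

Definition internal (T : finType) (V : {set T}) (F : rel T) : {set T} :=
  [set x in V | 1 < degree F x].

Definition internal_vertex_subtree : parameterized := fun x k =>
  exists G : graph, x = enc_graph G /\
    exists (V : {set 'I_(order G)}) (F : rel 'I_(order G)),
      [/\ is_subgraph V F, is_tree V F & k <= #|internal V F|].

(* Main.v *)
(* Let L be in NP.  For every length n there is a graph, with polynomially many
   vertices, in which a subtree with k = k(n) internal vertices encodes an
   accepting run of the verifier of L on a given word of length n and some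
   witness; only the presence of certain edges depends on the word, each on a
   single bit of it.  A subtree lies in one component, so the disjoint union of
   the graphs of x_1, ..., x_t has such a subtree iff some x_i is in L, for the
   same k.

   A polynomial kernel maps these unions to words of length bounded in n alone.
   For t larger than twice this length, at most n + 1 outputs z suffice for every
   x not in L to occur in a tuple outside L that is mapped to one of them
   (Fortnow and Santhanam).  The advice for length n lists these z, and, for each
   position i of x among the words x_1, ..., x_t, a program that writes down the
   union graph: it emits the bits of the instance by looking up bits of x and of
   the certificate, which contains the other words.  No reduction has to be
   computed uniformly, so one explicit machine, which runs such a program, then
   the kernelization, then a comparison with z, puts the complement of L in
   NP/poly. *)

Require Import Defs.
From HB Require Import structures.
From mathcomp Require Import all_boot all_order all_algebra zify boolp.

Set Implicit Arguments.
Unset Strict Implicit.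
Unset Printing Implicit Defensive.

(** The parameter is the number of core vertices of one component, and no tree can have more
    internal vertices; reaching it forces every core vertex to be internal. A vertex has only one
    parent, so a supply can serve its own literal or a clause, never both; this is how a tree
    expresses a consistent valuation. The verifier has to be an actual machine with a time bound on
    every input, meaningless certificates included. So nothing is validated beforehand: wherever the
    certificate enters the advice, the machine rejects or runs a listed program, and any certificate
    text stands for some tuple with x in its place. Moreover, [MK] is known to halt in time only on
    codes of instances, that is, on words containing a 0. The last bit of every union instance is 0
    and the first is 1; the machine writes the former before the program starts and the latter when
    it ends, so that even garbage yields an instance. *)

(** * Polynomially bounded functions *)

Definition poly_bounded (f : nat -> nat) : Prop :=
  exists p : {poly nat}, forall n, f n <= (p.[n])%R.

Lemma horner_nat_mono (p : {poly nat}) (m n : nat) :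
  m <= n -> (p.[m])%R <= (p.[n])%R.
Proof.
move=> le_mn; rewrite !horner_coef; apply: leq_sum => i _.
apply: leq_mul => //; elim: (nat_of_ord i) => [//|j IHj].
by rewrite !GRing.exprS; exact: leq_mul.
Qed.

Lemma poly_bounded_const c : poly_bounded (fun _ => c).
Proof. by exists (c%:P)%R => n; rewrite hornerC. Qed.

Lemma poly_bounded_id : poly_bounded id.
Proof. by exists ('X)%R => n; rewrite hornerX. Qed.

Lemma poly_bounded_add f g :
  poly_bounded f -> poly_bounded g -> poly_bounded (fun n => f n + g n).
Proof. by case=> p hp [q hq]; exists (p + q)%R => n; rewrite hornerD leq_add. Qed.

Lemma poly_bounded_mul f g :
  poly_bounded f -> poly_bounded g -> poly_bounded (fun n => f n * g n).
Proof. by case=> p hp [q hq]; exists (p * q)%R => n; rewrite hornerM leq_mul. Qed.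

Lemma poly_bounded_horner (p : {poly nat}) f :
  poly_bounded f -> poly_bounded (fun n => (p.[f n])%R).
Proof.
case=> q hq; exists (p \Po q)%R => n.
by rewrite horner_comp; exact: horner_nat_mono.
Qed.

Lemma poly_bounded_le f g :
  (forall n, f n <= g n) -> poly_bounded g -> poly_bounded f.
Proof. by move=> le_fg [p hp]; exists p => n; exact: leq_trans (hp n). Qed.

(** * Orientations and parent maps of trees *)

Definition acyclic (T : eqType) (F : rel T) :=
  forall c : seq T, ucycle F c -> size c <= 2.

Lemma acyclic_sub (T : eqType) (F F' : rel T) :
  subrel F' F -> acyclic F -> acyclic F'.
Proof.
move=> sub acF c /andP[cyc uc]; apply: acF; rewrite /ucycle uc andbT.
by apply: sub_cycle cyc.
Qed.

(** The far end of a longest simple path is a leaf: a neighbour off the path would prolong it, and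
    one on the path other than the predecessor would close a cycle of at least three vertices. The
    path starts at [r] if [r] has a neighbour, and otherwise no edge reaches [r]; so the far end is
    not [r]. *)
Lemma acyclic_leaf (T : finType) (F : rel T) (r x y : T) :
  symmetric F -> irreflexive F -> acyclic F -> F x y ->
  exists v u, [/\ v != r, F v u & forall w, F v w -> w = u].
Proof.
move=> symF irrF acF Fxy.
have [x0 [y0 [Fxy0 hx0]]] : exists x0 y0, F x0 y0 /\
    forall p, path F x0 p -> uniq (x0 :: p) -> p != [::] -> last x0 p != r.
  case: (pickP (F r)) => [y0 Fry0|noF].
    exists r, y0; split=> // p _ /= /andP[rp _]; case: p rp => //= a p rp _.
    by apply: contra rp => /eqP <-; exact: mem_last.
  exists x, y; split=> // p; case/lastP: p => // p z.
  rewrite rcons_path last_rcons => /andP[_ Fpz] _ _.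
  by apply: contraFneq (noF (last x p)) => <-; rewrite symF.
pose good n := [exists p : n.-tuple T, path F x0 p && uniq (x0 :: p)].
have good1 : good 1.
  apply/existsP; exists [tuple y0]; rewrite /= andbT Fxy0 inE andbT.
  by apply: contraTneq Fxy0 => ->; rewrite irrF.
have good_bound n : good n -> n <= #|T|.
  case/existsP=> p /andP[_ up]; have := card_uniqP up.
  rewrite /= size_tuple => en; rewrite ltnW // -en; exact: max_card.
have exg : exists n, good n by exists 1.
case: (ex_maxnP exg good_bound) => n /existsP[p /andP[Fp up]] maxn.
have : 0 < n by exact: maxn.
case: n p Fp up maxn => // n p0 Fp up maxn _.
have szp := size_tuple p0; move: (p0 : seq T) szp Fp up => p {p0}.
case/lastP: p => // p z szp; rewrite rcons_path => /andP[Fp Fpz] up.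
exists z, (last x0 p); split.
- have := hx0 (rcons p z); rewrite last_rcons; apply=> //.
    by rewrite rcons_path Fp.
  by case: (p).
- by rewrite symF.
move=> w Fzw; case: (boolP (w \in x0 :: rcons p z)) => [|wnew]; last first.
  suff: good n.+2 by move/maxn; rewrite ltnn.
  have szw : size (rcons (rcons p z) w) == n.+2 by rewrite size_rcons szp.
  apply/existsP; exists (Tuple szw); rewrite [tval _]/=.
  rewrite rcons_path last_rcons Fzw rcons_path Fp Fpz /=.
  by rewrite -[_ && _]/(uniq (rcons (x0 :: rcons p z) w)) rcons_uniq wnew up.
rewrite -rcons_cons mem_rcons inE => /orP[/eqP wz|wp].
  by move: Fzw; rewrite wz irrF.
case/splitPr: {-1}_ / wp (erefl (x0 :: p)) => p1 p2 ep.
have cyc : ucycle F (w :: rcons p2 z).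
  have: path F x0 (rcons p z) by rewrite rcons_path Fp.
  move: up; rewrite -rcons_cons ep rcons_cat cat_uniq => /and3P[_ _ up].
  case: p1 ep up Fzw => [[<- <-]|a p1 [_ ep]] up Fzw; rewrite /ucycle.
    move=> Fpz'; apply/andP; split; last exact: up.
    by rewrite /= rcons_path Fpz' last_rcons Fzw.
  rewrite ep rcons_cat cat_path => /andP[_] /= /andP[_ Fw].
  by apply/andP; split; [rewrite /= rcons_path Fw last_rcons | exact: up].
have := acF _ cyc; rewrite /= size_rcons !ltnS leqn0 size_eq0 => /eqP p2E.
by have := congr1 (last x0) ep; rewrite p2E last_cat.
Qed.

Definition edges (T : finType) (F : rel T) := #|[set e : T * T | F e.1 e.2]|.

(** Leaves other than [r] are removed one at a time, each directed to its only neighbour; [D u v]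
    reads: [v] is the parent of [u]. *)
Lemma acyclic_orientation (T : finType) (F : rel T) (r : T) :
  symmetric F -> irreflexive F -> acyclic F ->
  exists D : rel T, [/\ forall u v, F u v -> D u v (+) D v u,
    subrel D F, forall u v w, D u v -> D u w -> v = w & forall v, ~~ D r v].
Proof.
have [n] := ubnP (edges F); elim: n F => // n IHn F ltn symF irrF acF.
case: (pickP [pred e : T * T | F e.1 e.2]) => [[x y] /= Fxy|noF]; last first.
  exists (fun _ _ => false); split=> // u v Fuv.
  by have /= := noF (u, v); rewrite Fuv.
have [v [u [vr Fvu uniqu]]] := acyclic_leaf r symF irrF acF Fxy.
pose F' a b := [&& F a b, a != v & b != v].
have [|||| D [D1 D2 D3 D4]] := IHn F'.
- rewrite -ltnS; apply: leq_trans ltn; rewrite ltnS; apply: proper_card.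
  apply/properP; split.
    by apply/subsetP=> -[a b]; rewrite !inE => /and3P[].
  by exists (v, u); rewrite inE //= /F' eqxx !andbF.
- by move=> a b; rewrite /F' symF; congr andb; rewrite andbC.
- by move=> a; rewrite /F' irrF.
- by apply: acyclic_sub acF => a b /and3P[].
exists (fun a b => D a b || (a == v) && (b == u)); split.
- have vu : v != u by apply: contraTneq Fvu => ->; rewrite irrF.
  move=> a b Fab; case: (eqVneq a v) => [av|av] /=.
    move: Fab; rewrite av => Fvb; rewrite (uniqu b Fvb) eqxx (negPf vu) andbF orbT.
    by rewrite orbF addTb; apply/negP => /D2 /and3P[_ _]; rewrite eqxx.
  case: (eqVneq b v) => [bv|bv] /=.
    move: Fab; rewrite bv symF => Fva; rewrite (uniqu a Fva) eqxx orbT addbT orbF.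
    by apply/negP => /D2 /and3P[_ _]; rewrite eqxx.
  by rewrite !orbF; apply: D1; rewrite /F' Fab av bv.
- move=> a b /orP[/D2 /and3P[]//|/andP[/eqP-> /eqP->]] //.
- move=> a b c /orP[Dab|/andP[/eqP-> /eqP->]] /orP[Dac|/andP[/eqP av /eqP->]] //.
  + exact: D3 Dab Dac.
  + by case/D2/and3P: Dab => _; rewrite av eqxx.
  + by case/D2/and3P: Dac => _; rewrite eqxx.
- by move=> b; rewrite negb_or D4 /= negb_and eq_sym vr.
Qed.

Definition parent_rel (T : finType) (V : {set T}) (r : T) (par : T -> T) : rel T :=
  fun u v => [&& u \in V, v \in V &
    (u != r) && (par u == v) || (v != r) && (par v == u)].

Lemma parent_rel_sym (T : finType) (V : {set T}) (r : T) (par : T -> T) :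
  symmetric (parent_rel V r par).
Proof. by move=> u v; rewrite /parent_rel andbCA orbC. Qed.

(** On a cycle of three or more vertices, both cyclic neighbours of a vertex of maximal rank would
    be its parent and hence coincide. *)
Lemma is_tree_parent (T : finType) (V : {set T}) (r : T) (par : T -> T)
    (rk : T -> nat) :
  r \in V ->
  (forall v, v \in V -> v != r -> (par v \in V) /\ rk (par v) < rk v) ->
  is_tree V (parent_rel V r par).
Proof.
move=> rV hpar; have csym := sym_connect_sym (@parent_rel_sym _ V r par).
have tor v : v \in V -> connect (parent_rel V r par) v r.
  have [n] := ubnP (rk v); elim: n v => // n IHn v ltn vV.
  have [->|vr] := eqVneq v r; first exact: connect0.
  have [pV lt_rk] := hpar v vV vr.
  apply: (@connect_trans _ _ (par v)).
    by apply: connect1; rewrite /parent_rel vV pV vr eqxx.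
  by apply: IHn => //; apply: leq_trans lt_rk _; rewrite -ltnS.
split.
- by apply/set0Pn; exists r.
- by move=> x y xV yV; apply: (connect_trans (tor x xV)); rewrite csym tor.
move=> c /andP[cyc uc]; rewrite leqNgt; apply/negP => szc.
have [x0 x0c] : exists x, x \in c by case: c szc {cyc uc} => // x c;
    exists x; rewrite mem_head.
case: (@arg_maxnP _ x0 (mem c) rk x0c) => x xc maxx.
have [i c' ec] := rot_to xc.
have sz' : size (x :: c') > 2 by rewrite -ec size_rot.
move: uc cyc; rewrite -(rot_uniq i) -(rot_cycle i) ec.
have maxx' z : z \in c' -> rk z <= rk x.
  by move=> zc; apply: maxx; rewrite /= -(mem_rot i) ec inE zc orbT.
case: c' {ec} sz' maxx' => // y [|z c'] // _ maxx' uc.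
have up w : w \in y :: z :: c' -> parent_rel V r par x w -> par x = w.
  move=> wc /and3P[xV wV /orP[/andP[_ /eqP]//|/andP[wr /eqP pw]]].
  by have [_] := hpar w wV wr; rewrite pw ltnNge maxx'.
rewrite /= => /andP[Fxy]; rewrite rcons_path => /andP[_ Flast].
have : y = last z c'.
  rewrite -(up _ _ Fxy) ?mem_head // (up (last z c')) //.
    by rewrite inE mem_last orbT.
  by rewrite parent_rel_sym; case/andP: Flast.
move=> ey; move: uc => /= /andP[_ /andP[]].
by rewrite ey mem_last.
Qed.

(** * Subtrees of graphs on a finite type *)

Definition has_subtree (V : finType) (e : rel V) (k : nat) : Prop :=
  exists (W : {set V}) (F : rel V),
    [/\ symmetric F, subrel F e, forall x y, F x y -> x \in W /\ y \in W,
        is_tree W F & k <= #|internal W F|].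

Lemma has_subtree_bij (T U : finType) (f : T -> U) (g : U -> T) (e : rel T) k :
  cancel f g -> cancel g f ->
  has_subtree e k -> has_subtree (fun a b => e (g a) (g b)) k.
Proof.
move=> fK gK [W [F [symF subF FW [neW conW acF] leW]]].
have bij (R : {set T}) : #|g @^-1: R| = #|R|.
  apply: on_card_preimset; apply: onW_bij; exact: (Bijective gK fK).
exists (g @^-1: W), (fun a b => F (g a) (g b)); split.
- by move=> a b; rewrite symF.
- by move=> a b; exact: subF.
- by move=> a b /FW[]; rewrite !inE.
- split.
  + by rewrite -card_gt0 bij card_gt0.
  + move=> a b; rewrite !inE => aW bW; have := conW _ _ aW bW.
    case/connectP=> p Fp eb; rewrite -[a]gK -[b]gK eb; elim: p (g a) Fp {eb} => //=.
    move=> z p IHp x /andP[Fxz Fp]; apply: (@connect_trans _ _ (f z)).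
      by apply: connect1; rewrite !fK.
    exact: IHp.
  + move=> c /andP[cyc uc]; rewrite -(size_map g); apply: acF.
    by rewrite /ucycle (map_inj_uniq (can_inj gK)) uc cycle_map cyc.
- apply: leq_trans leW _; rewrite -(bij (internal W F)).
  apply: eq_leq; apply: eq_card => a; rewrite !inE; congr andb.
  by rewrite /degree -bij; congr (_ < _); apply: eq_card => b; rewrite !inE.
Qed.

Definition graph_of (V : finType) (e : rel V) (es : symmetric e)
    (ei : irreflexive e) : graph :=
  @Graph #|V| (fun a b => e (enum_val a) (enum_val b))
    (fun a b => es (enum_val a) (enum_val b)) (fun a => ei (enum_val a)).

Lemma unary_sep_inj m n (x y : word) :
  unary m ++ false :: x = unary n ++ false :: y -> m = n /\ x = y.
Proof.
elim: m n => [|m IHm] [|n] //=; first by case.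
by case=> /IHm[-> ->].
Qed.

Lemma allpairs_inj_fun (S T R : eqType) (f g : S -> T -> R) s t :
  [seq f i j | i <- s, j <- t] = [seq g i j | i <- s, j <- t] ->
  {in s & t, f =2 g}.
Proof.
elim: s => [|a s IHs] //= /eqP; rewrite eqseq_cat ?size_map // => /andP[/eqP e1].
move=> /eqP /IHs e2 i j; rewrite inE => /orP[/eqP->|si] tj; last exact: e2.
by move/eq_in_map: e1 => ->.
Qed.

(** The code determines the order and the adjacency matrix, so the graph quantified in
    [internal_vertex_subtree] has these very edges; [enum_val] carries subtrees over to [V]. *)
Lemma ivst_graph_of (V : finType) (e : rel V) (es : symmetric e)
    (ei : irreflexive e) k :
  internal_vertex_subtree (enc_graph (graph_of es ei)) k <-> has_subtree e k.
Proof.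
have side (F : rel 'I_#|V|) : F =2 (fun a b => e (enum_val a) (enum_val b)) ->
    has_subtree F k <-> has_subtree e k.
  move=> eF; split.
    move=> /(has_subtree_bij (@enum_valK V) (@enum_rankK V)) [W [H [h1 h2 h3 h4 h5]]].
    exists W, H; split=> // a b /h2; by rewrite eF !enum_rankK.
  move=> /(has_subtree_bij (@enum_rankK V) (@enum_valK V)) [W [H [h1 h2 h3 h4 h5]]].
  by exists W, H; split=> // a b /h2; rewrite eF.
split.
  case=> -[n e' es' ei'] [/= eqG].
  have [en eqm] := unary_sep_inj eqG; simpl in en, eqm; subst n.
  move=> [W [F [[symF subF FW] tF leF]]].
  have eqe : e' =2 (fun a b => e (enum_val a) (enum_val b)).
    by move=> a b; symmetry; apply: (allpairs_inj_fun eqm); rewrite mem_enum.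
  by apply: (side e' eqe).1; exists W, F.
move=> h; have {h} := (side (@edge (graph_of es ei)) (fun _ _ => erefl)).2 h.
case=> W [F [symF subF FW tF leF]].
by exists (graph_of es ei); split=> //; exists W, F.
Qed.

(** * The gadget graph *)

Section Gadget.
Variables (X C : finType).

Notation port := (X * bool * bool)%type.

(* Every variable x has two ports of each sign, each of which is a literal of at
   most one clause.  Orient a tree in which all core vertices are internal
   towards Root.  Then Link x None has a child Port (x, s, true), which forces
   both ports of x of sign s to take their own Supply as a child; these are the
   false literals.  An active clause has a child as well, namely the Supply of a
   literal that did not take it. *)
Inductive core :=
  | Root | Link of X & option bool | Port of port | Supply of port
  | Clause of C | Extra of C.

Definition core_code (u : core) :
    option (X * option bool) + (port + port) + (C + C) :=
  match u with
  | Root => inl (inl None) | Link x o => inl (inl (Some (x, o)))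
  | Port p => inl (inr (inl p)) | Supply p => inl (inr (inr p))
  | Clause c => inr (inl c) | Extra c => inr (inr c)
  end.

Definition core_decode c : core :=
  match c with
  | inl (inl None) => Root | inl (inl (Some (x, o))) => Link x o
  | inl (inr (inl p)) => Port p | inl (inr (inr p)) => Supply p
  | inr (inl c) => Clause c | inr (inr c) => Extra c
  end.

Lemma core_codeK : cancel core_code core_decode.
Proof. by case. Qed.

HB.instance Definition _ := Finite.copy core (can_type core_codeK).

Lemma card_core : #|{: core}| <= 1 + #|X| * 3 + #|X| * 8 + 2 * #|C|.
Proof.
have := leq_card _ (can_inj core_codeK).
rewrite !card_sum !card_option !card_prod !card_option card_bool => h.
by apply: leq_trans h _; lia.
Qed.

Definition free (u : core) : bool :=
  match u with Root | Supply _ | Extra _ => true | _ => false end.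

Section Edges.
Variables (J : finType) (cl : port -> option C) (active : J -> C -> bool).

(** Each variable [x] gives a cycle of eight vertices: [Root], [Link x (Some true)], the two ports
    of sign true, [Link x None], the two ports of sign false, [Link x (Some false)]. The undecided
    [Link x None] lies opposite [Root]. *)
Definition arc (j : J) (u v : core) : bool :=
  match u, v with
  | Root, Link _ (Some _) | Root, Clause _ | Root, Extra _ => true
  | Link x (Some s), Port (x', s', i) => [&& x == x', s == s' & ~~ i]
  | Port (x, s, i), Port (x', s', i') => [&& x == x', s == s', ~~ i & i']
  | Port (x, _, i), Link x' None => (x == x') && i
  | Port p, Supply q => p == q
  | Supply p, Clause c => cl p == Some c
  | Clause c, Extra c' => (c == c') && ~~ active j c
  | _, _ => false
  end.

Lemma arc_irr j u : arc j u u = false.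
Proof. by case: u => //= [x [] //|[[x s] i]]; rewrite !eqxx /=; case: i. Qed.

Notation vertex := (J * core * bool)%type.

(* (j, u, false) is the copy of u in component j; (j, u, true) is a leaf attached
   to it that makes it internal at no cost when u is free, and isolated
   otherwise. *)
Definition garc (u v : vertex) : bool :=
  [&& u.1.1 == v.1.1, ~~ u.2 & if v.2 then (u.1.2 == v.1.2) && free u.1.2
                               else arc u.1.1 u.1.2 v.1.2].

Definition gedge (u v : vertex) : bool := garc u v || garc v u.

Lemma gedge_sym : symmetric gedge.
Proof. by move=> u v; rewrite /gedge orbC. Qed.

Lemma gedge_irr : irreflexive gedge.
Proof. by case=> -[j u] b; rewrite /gedge /garc /= eqxx arc_irr; case: b. Qed.

Definition satisfied (j : J) (val : X -> bool) : Prop :=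
  forall c, active j c -> exists p : port, cl p = Some c /\ val p.1.1 = p.1.2.

(** An attached leaf has at most one neighbour and a tree stays in one component, so this many
    internal vertices exhaust the core of a component. A vertex that is not free then has two
    neighbours in the core, at most one of them its parent, hence a child there. [P u v] reads: [v]
    is a child of [u]. *)
Lemma sat_of_subtree :
  has_subtree gedge #|{: core}| -> exists j val, satisfied j val.
Proof.
case=> W [F [symF subF FW [_ conW acF] leF]].
have irrF : irreflexive F by move=> v; apply: contraFF (gedge_irr v) => /subF.
have FJ u v : F u v -> u.1.1 = v.1.1.
  by move/subF; case/orP => /and3P[/eqP].
have pend v : v \in internal W F -> v.2 = false.
  rewrite inE => /andP[_ /card_gt1P[a [b []]]]; rewrite !inE => Fa Fb.
  apply: contraNF => v2.
  have uniq w : F v w -> w = (v.1, false).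
    case: w => -[jw w] bw /subF; rewrite /gedge /garc v2 /= andbF /=.
    case/and3P=> /eqP -> bw0 /andP[/eqP -> _]; rewrite (negPf bw0).
    by case: (v) => -[].
  by rewrite (uniq _ Fa) (uniq _ Fb).
have [v0 v0I] : exists v, v \in internal W F.
  apply/set0Pn; rewrite -card_gt0; apply: leq_trans leF.
  by apply/card_gt0P; exists Root.
set j := v0.1.1; exists j.
have int_j v : v \in internal W F -> v = (j, v.1.2, false).
  move=> vI; have := pend v vI.
  suff: v.1.1 = j by case: v {vI} => -[jv u] b /= -> ->.
  apply/eqP; have: closed F [pred w : vertex | w.1.1 == j].
    by move=> a b /FJ; rewrite !inE => ->.
  move/closed_connect => /(_ v0 v); rewrite !inE eqxx => <- //.
  by apply: conW; [move: v0I | move: vI]; rewrite inE => /andP[].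
have int_all u : (j, u, false) \in internal W F.
  have/setP/(_ u): [set v.1.2 | v in internal W F] = [set: core].
    apply/eqP; rewrite eqEcard subsetT cardsT card_in_imset //.
    by move=> a b aI bI e; rewrite (int_j a aI) (int_j b bI) e.
  by rewrite inE => /imsetP[v vI ->]; rewrite -int_j.
have [D [D1 D2 D3 D4]] := acyclic_orientation (j, Root, false) symF irrF acF.
pose P u v := D (j, v, false) (j, u, false).
have P1 u v : P u v -> arc j u v || arc j v u.
  by move/D2/subF; rewrite /gedge /garc /= eqxx orbC.
have P2 u u' v : P u v -> P u' v -> u = u'.
  by move=> h h'; have [] := D3 _ _ _ h h'.
have P3 u : P u Root -> False by move=> h; case/negP: (D4 (j, u, false)).
have P5 u v : P u v -> ~~ P v u.
  by move=> h; have := D1 _ _ (D2 _ _ h); rewrite /P; move: h; rewrite /P => ->.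
have P4 u : ~~ free u -> exists v, P u v.
  move=> nfu; have := int_all u.
  rewrite inE => /andP[_ /card_gt1P[a [b []]]]; rewrite !inE => Fa Fb ab.
  have core_nbr w : F (j, u, false) w -> w = (j, w.1.2, false).
    move=> Fw; have := subF _ _ Fw; have := FJ _ _ Fw; case: w {Fw} => -[j' w] [] /= ->.
      by rewrite /gedge /garc /= (negPf nfu) !andbF.
    by [].
  have [h|h] := boolP (D a (j, u, false)).
    by exists a.1.2; rewrite /P -core_nbr.
  exists b.1.2; rewrite /P -core_nbr //.
  have := D1 _ _ Fa; rewrite (negPf h) addbF => Da.
  have := D1 _ _ Fb; case: (boolP (D _ b)) => // Db _.
  by case/eqP: ab; exact: D3 Da Db.
(* [Root] is nobody's child, so [Link x (Some s)] takes the port next to it. For both ports of sign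
   [s], each neighbour on the cycle is now its parent or the child of another vertex; only the
   supply is left. *)
have consume x s : P (Link x None) (Port (x, s, true)) ->
    forall i, P (Port (x, s, i)) (Supply (x, s, i)).
  move=> Py.
  have Ps : P (Link x (Some s)) (Port (x, s, false)).
    have [v Pv] := P4 (Link x (Some s)) isT; have := P1 _ _ Pv.
    case: v Pv => [|x' o|[[x' s'] i]|q|c|c] //= Pv; first by case: (P3 _ Pv).
      by case: o Pv.
    by rewrite ?orbF => /and3P[/eqP ex /eqP es]; subst x' s'; case: i Pv.
  move=> i; have [v Pv] := P4 (Port (x, s, i)) isT; have := P1 _ _ Pv.
  case: i v Pv => -[|x' [s'|]|[[x' s'] []]|q|c|c] //= Pv; rewrite ?andbF ?andbT ?orbF //.
  - by move=> /eqP ex; subst x'; have := P5 _ _ Pv; rewrite Py.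
  - case/andP=> /eqP ex /eqP es; subst x' s'.
    by have := P2 _ _ _ Pv Ps.
  - by move=> /eqP eq; move: Pv; rewrite eq.
  - by case/andP=> /eqP ex /eqP es; subst x' s'; have := P5 _ _ Pv; rewrite Ps.
  - case/andP=> /eqP ex /eqP es; subst x' s'.
    by have := P2 _ _ _ Pv Py.
  - by move=> /eqP eq; move: Pv; rewrite eq.
(* If ports of both signs hang below [Link x None], no clause has a supply of [x] as a child, and
   either value would do. *)
exists (fun x => ~~ P (Link x None) (Port (x, true, true))) => c act_c.
have [v Pv] := P4 (Clause c) isT; have := P1 _ _ Pv.
case: v Pv => [|x o|[[x s] i]|[[x s] i]|c1|c1] //= Pv; first by case: (P3 _ Pv).
- by case: o Pv.
2: by rewrite orbF act_c andbF.
move=> /eqP clp; exists (x, s, i); split=> //=.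
have nP : ~~ P (Link x None) (Port (x, s, true)).
  by apply/negP => /consume /(_ i) h; have := P2 _ _ _ h Pv.
case: s {Pv clp} nP => // nP.
have [v Pv] := P4 (Link x None) isT; have := P1 _ _ Pv.
case: v Pv => [|x' o|[[x' s] i']|q|c'|c'] //= Pv; first by case: o Pv.
case/andP=> /eqP ex i'T; subst x'.
by case: i' s i'T Pv => -[] // _ Pv; [rewrite Pv | rewrite Pv in nP].
Qed.

Section TreeOfSat.
Variables (j : J) (val : X -> bool) (x0 : X).
Hypothesis sat : satisfied j val.

(** The ports of the true sign [val x] form a chain down to [Link x None], which carries the outer
    port of the other sign. Thus the true ports have children on the cycle and their supplies are
    left for the clauses. *)
Definition core_parent (u : core) : core :=
  match u with
  | Root | Link _ (Some _) | Clause _ => Root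
  | Link x None => Port (x, val x, true)
  | Port (x, s, false) => Link x (Some s)
  | Port (x, s, true) => if s == val x then Port (x, s, false) else Link x None
  | Supply p =>
      if cl p is Some c then if val p.1.1 == p.1.2 then Clause c else Port p
      else Port p
  | Extra c => if active j c then Root else Clause c
  end.

(** Not the depth, only a number that drops along [core_parent]; the 6 of a supply exceeds the rank
    of each of its possible parents. *)
Definition core_rank (u : core) : nat :=
  match u with
  | Root => 0 | Link _ (Some _) | Clause _ => 1 | Extra _ => 2
  | Port (x, s, false) => 2 | Link _ None => 4 | Supply _ => 6
  | Port (x, s, true) => if s == val x then 3 else 5
  end.

Lemma core_parentP u : u != Root ->
  core_rank (core_parent u) < core_rank u /\
  arc j (core_parent u) u || arc j u (core_parent u).
Proof.
case: u => [|x [s|]|[[x s] []]|[[x s] i]|c|c] _ //=; rewrite ?eqxx ?orbT //=.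
- by case: (eqVneq s (val x)) => [->|_] /=; rewrite !eqxx.
- case: (cl _) (erefl (cl (x, s, i))) => [c|] /= ec.
    by case: (val x == s); rewrite /= ?ec !eqxx ?orbT; case: (i) => //; case: (_ == _).
  by rewrite eqxx; case: (i) => //; case: (_ == _).
- by case: (boolP (active j c)) => /= ac; rewrite ?eqxx ?ac.
Qed.

Lemma core_child u : ~~ free u -> exists2 v, v != Root & core_parent v = u.
Proof.
case: u => [|x [s|]|[[x s] []]|[[x s] i]|c|c] // _.
- by exists (Port (x, s, false)).
- by exists (Port (x, ~~ val x, true)) => //=; case: (val x).
- have [es|ns] := eqVneq s (val x); first by exists (Link x None); rewrite //= es.
  exists (Supply (x, s, true)) => //=.
  by case: (cl _) => //; rewrite eq_sym (negPf ns).
- have [es|ns] := eqVneq s (val x).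
    by exists (Port (x, s, true)); rewrite //= es eqxx.
  exists (Supply (x, s, false)) => //=.
  by case: (cl _) => //; rewrite eq_sym (negPf ns).
- have [/sat[p [clp valp]]|/negPf ina] := boolP (active j c).
    by exists (Supply p); rewrite //= clp valp eqxx.
  by exists (Extra c); rewrite //= ina.
Qed.

Definition tree_vertices : {set vertex} :=
  [set v : vertex | (v.1.1 == j) && (v.2 ==> free v.1.2)].

Definition tree_parent (v : vertex) : vertex :=
  let: (i, u, b) := v in if b then (i, u, false) else (i, core_parent u, false).

Lemma tree_parentP v : v \in tree_vertices -> v != (j, Root, false) ->
  [/\ tree_parent v \in tree_vertices, gedge v (tree_parent v)
    & core_rank (tree_parent v).1.2 + (tree_parent v).2 < core_rank v.1.2 + v.2].
Proof.
case: v => -[i u] []; rewrite inE /= => /andP[/eqP-> fu].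
  by rewrite inE /gedge /garc /= !eqxx fu addn0 addn1.
rewrite !xpair_eqE eqxx andbT /= => /core_parentP[lt_rk e].
by rewrite inE /gedge /garc /= !eqxx !addn0 orbC.
Qed.

Lemma subtree_of_sat : has_subtree gedge #|{: core}|.
Proof.
set r : vertex := (j, Root, false).
have rV : r \in tree_vertices by rewrite inE eqxx.
exists tree_vertices, (parent_rel tree_vertices r tree_parent); split.
- exact: parent_rel_sym.
- move=> a b /and3P[aV bV /orP[]] /andP[ar /eqP <-].
    by have [] := tree_parentP aV ar.
  by rewrite gedge_sym; have [] := tree_parentP bV ar.
- by move=> a b /and3P[].
- apply: (is_tree_parent (rk := fun v : vertex => core_rank v.1.2 + v.2)) => // v vV vr.
  by have [] := tree_parentP vV vr.
have inj : injective (fun u : core => (j, u, false) : vertex) by move=> a b [].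
rewrite -cardsT -(card_imset _ inj); apply: subset_leq_card.
apply/subsetP => _ /imsetP[u _ ->]; rewrite inE inE eqxx /=.
have uV : (j, u, false) \in tree_vertices by rewrite inE eqxx.
apply/card_gt1P.
(* Two neighbours of each core vertex: its parent and a child, namely its own leaf if it is free and
   a core child otherwise. [Root] has its leaf and the link of [x0] instead. *)
suff [a [b [aV bV ab [ar pa] hb]]] : exists a b, [/\ a \in tree_vertices,
    b \in tree_vertices, a != b, a != r /\ tree_parent a = (j, u, false) &
    (b != r /\ tree_parent b = (j, u, false)) \/
    (u != Root /\ tree_parent (j, u, false) = b)].
  exists a, b; split=> //; rewrite inE /parent_rel uV ?aV ?bV ?ar ?pa ?eqxx ?orbT //=.
  case: hb => [[-> ->]|[ur <-]]; first by rewrite eqxx orbT.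
  have -> : (j, u, false) != r by rewrite !xpair_eqE eqxx andbT.
  by rewrite eqxx.
have bneq (u1 u2 : core) : (j, u1, true) != (j, u2, false).
  by rewrite xpair_eqE andbF.
have inV c : (j, c, false) \in tree_vertices by rewrite inE eqxx.
have [fu|nfu] := boolP (free u).
  have pV : (j, u, true) \in tree_vertices by rewrite inE eqxx.
  have [->|ur] := eqVneq u Root.
    exists (j, Root, true), (j, Link x0 (Some true), false).
    split; [by rewrite inE eqxx|exact: inV|exact: bneq|by split=> //; exact: bneq|left].
    by split=> //; rewrite xpair_eqE andbT xpair_eqE eqxx.
  exists (j, u, true), (j, core_parent u, false).
  by split; [exact: pV|exact: inV|exact: bneq|split=> //; exact: bneq|right].
have [v vr pv] := core_child nfu.
have ur : u != Root by apply: contraNneq nfu => ->.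
exists (j, v, false), (j, core_parent u, false); split=> //.
- apply/negP => /eqP [ev]; have [+ _] := core_parentP vr.
  have [+ _] := core_parentP ur; rewrite pv -ev => h1 h2.
  by have := ltn_trans h1 h2; rewrite ltnn.
- by split; [rewrite !xpair_eqE eqxx andbT | rewrite -pv].
- by right.
Qed.

End TreeOfSat.

Lemma subtree_satP (x0 : X) :
  has_subtree gedge #|{: core}| <-> exists j val, satisfied j val.
Proof.
by split; [exact: sat_of_subtree | case=> j [val]; exact: subtree_of_sat].
Qed.

End Edges.
End Gadget.

(** * Constraint satisfaction *)

Section CycleSucc.
Variable O : finType.

Definition osucc (o : O) : O := enum_val (ordS (enum_rank o)).
Definition opred (o : O) : O := enum_val (ord_pred (enum_rank o)).

Lemma osuccK : cancel osucc opred.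
Proof. by move=> o; rewrite /opred enum_valK ordSK enum_rankK. Qed.

Lemma opredK : cancel opred osucc.
Proof. by move=> o; rewrite /osucc enum_valK ord_predK enum_rankK. Qed.

Lemma osucc_const (f : O -> bool) (o o' : O) :
  (forall o, f o -> f (osucc o)) -> f o -> f o'.
Proof.
move=> f_succ fo; have fk k : f (iter k osucc o) by elim: k => //= k; exact: f_succ.
have rk k : enum_rank (iter k osucc o) = (enum_rank o + k) %% #|O| :> nat.
  elim: k => [|k IHk]; first by rewrite addn0 modn_small.
  by rewrite iterS enum_valK /= IHk -addn1 modnDml addn1 addnS.
have := fk (#|O| - enum_rank o + enum_rank o'); congr (is_true (f _)).
apply: enum_rank_inj; apply: val_inj; rewrite /= rk addnA subnKC 1?ltnW //.
by rewrite modnDl modn_small.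
Qed.
End CycleSucc.

Section Ring.
Variables (Var C O : finType) (lit : O -> Var * bool) (cls : O -> C).

(* Variable v has one copy (v, o) for each occurrence o of a literal.  The
   clauses inl (v, o) state the implications (v, o) -> (v, osucc o), which make
   all copies of v equal. *)
Definition ring_port (p : (Var * O) * bool * bool) : option ((Var * O) + C) :=
  let: ((v, o), s, i) := p in
  if i then if lit o == (v, s) then Some (inr (cls o)) else None
  else Some (inl (v, if s then opred o else o)).

Variables (J : finType) (active : J -> C -> bool).

Definition ring_active (j : J) (c : (Var * O) + C) : bool :=
  if c is inr c' then active j c' else true.

Lemma ring_satP (o0 : O) (j : J) :
  (exists val : Var * O -> bool, satisfied ring_port ring_active j val) <->
  exists val : Var -> bool, forall c, active j c ->
    exists o, cls o = c /\ val (lit o).1 = (lit o).2.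
Proof.
split=> [[val hval]|[val hval]]; last first.
  exists (fun vo => val vo.1) => -[[v o] _|c /hval[o [<- ho]]].
    case: (boolP (val v)) => valv.
      by exists (v, osucc o, true, false); rewrite /= osuccK.
    by exists (v, o, false, false); rewrite /= (negPf valv).
  by exists ((lit o).1, o, (lit o).2, true); rewrite /= -surjective_pairing eqxx.
have stepv v o : val (v, o) -> val (v, osucc o).
  have [[[[v' o'] s'] i'] []] := hval (inl (v, o)) isT.
  rewrite /=; case: i'; first by case: ifP.
  by case=> -> <-; case: s' => // h1 h2; [rewrite opredK|rewrite h1 in h2].
have constv v o o' : val (v, o) = val (v, o').
  by apply/idP/idP; apply: (@osucc_const _ (fun o => val (v, o))) => o''; exact: stepv.
exists (fun v => val (v, o0)) => c act_c.
have [[[[v o] s] i] []] := hval (inr c) act_c.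
rewrite /=; case: i => //; case: eqP => // lo [ec] valo.
by exists o; rewrite lo /= ec -(constv v o).
Qed.

End Ring.

Section Csp.
Variables (Var Kc Q J : finType) (scope : Kc -> Q -> Var).
Variable pred : J -> Kc -> {ffun Q -> bool} -> bool.

Definition csp_clause := (Kc * {ffun Q -> bool})%type.
Definition csp_occ := (Kc * {ffun Q -> bool} * Q)%type.

(* One clause per constraint and local assignment, active when the constraint
   forbids that assignment. *)
Definition csp_lit (o : csp_occ) : Var * bool := (scope o.1.1 o.2, ~~ o.1.2 o.2).
Definition csp_active (j : J) (c : csp_clause) : bool := ~~ pred j c.1 c.2.

Definition csp_vertex :=
  (J * core (Var * csp_occ)%type ((Var * csp_occ) + csp_clause)%type * bool)%type.

Definition csp_edge : rel csp_vertex :=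
  gedge (ring_port csp_lit fst) (ring_active csp_active).

(** A literal of the clause [(k, a)] says that the valuation differs from [a] at one place, so the
    clause holds exactly when the valuation does not restrict to [a] on the scope of [k]. *)
Lemma csp_subtreeP (k0 : Kc) (q0 : Q) (v0 : Var) :
  has_subtree csp_edge
    #|{: core (Var * csp_occ)%type ((Var * csp_occ) + csp_clause)%type}| <->
  exists j (val : Var -> bool), forall k, pred j k [ffun q => val (scope k q)].
Proof.
pose o0 : csp_occ := (k0, [ffun _ => false], q0).
have := subtree_satP (ring_port csp_lit fst) (ring_active csp_active) (v0, o0).
move=> [h1 h2]; split.
  case/h1=> j /(ring_satP csp_lit fst csp_active o0 j)[val hval]; exists j, val => k.
  apply: contraT => npred; have [[[k' a] q] [[ek ea]]] := hval (k, _) npred.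
  by rewrite /csp_lit /= ea ek ffunE; case: (val _).
case=> j [val hval]; apply: h2; exists j; apply/(ring_satP csp_lit fst csp_active o0 j).
exists val => -[k a] npred.
have [q hq] : exists q, val (scope k q) != a q.
  apply/existsP; apply: contraR npred; rewrite negb_exists => /forallP ha.
  suff -> : a = [ffun q => val (scope k q)] by exact: hval.
  by apply/ffunP=> q; rewrite ffunE; have := ha q; rewrite negbK => /eqP.
by exists (k, a, q); split=> //=; move: hq; case: (val _); case: (a q).
Qed.

End Csp.

(** [active] enters only in the edge between a clause and its [Extra]. This dichotomy is what lets
    an advice program produce each matrix bit by one look-up. *)
Lemma gedge_activeP (X C J : finType) (cl : X * bool * bool -> option C)
    (u v : (J * core X C * bool)%type) :
  (exists b, forall active, gedge cl active u v = b) \/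
  (exists j c, forall active, gedge cl active u v = ~~ active j c).
Proof.
case: u v => -[j a] bu [[j' a'] bv].
rewrite /gedge /garc /=; have [<-|jj'] := eqVneq j j'; last by left; exists false.
case: bu bv => [] [] /=; try by left; eexists.
case: a a' => [|x o|[[x s] i]|q|c|c] [|x' o'|[[x' s'] i']|q'|c'|c'] /=;
  try by left; eexists.
- have [_|_] := eqVneq c c'; last by left; exists false.
  by right; exists j, c => active; rewrite /= orbF.
- have [_|_] := eqVneq c' c; last by left; exists false.
  by right; exists j, c' => active.
Qed.

Lemma csp_edgeP (Var Kc Q J : finType) (scope : Kc -> Q -> Var)
    (u v : csp_vertex Var Kc Q J) :
  (exists b, forall pred, csp_edge scope pred u v = b) \/
  (exists j k a, forall pred, csp_edge scope pred u v = pred j k a).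
Proof.
have [[b hb]|[j [c hc]]] := gedge_activeP (ring_port (csp_lit scope) fst) u v.
  by left; exists b => pred; exact: hb.
case: c hc => [c|[k a]] hc; first by left; exists false => pred; exact: hc.
by right; exists j, k, a => pred; rewrite /csp_edge hc negbK.
Qed.

(** * Tableaux of Turing machines *)

(* The symbol at position [j - W] relative to the head. *)
Definition cell (t : tape) (W j : nat) : symbol :=
  if j < W then nth None (left_cells t) (W - j.+1)
  else nth None (scanned t :: right_cells t) (j - W).

Lemma cell_head t W : cell t W W = scanned t.
Proof. by rewrite /cell ltnn subnn. Qed.

Lemma nth_head_behead (T : Type) (x0 : T) s i :
  nth x0 (head x0 s :: behead s) i = nth x0 s i.
Proof. by case: s => //=; case: i => //= i; rewrite nth_nil. Qed.

Lemma cell_write_move t a d W j j' :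
  match d with
  | GoLeft => j = j'.+1 | Stay => j = j' | GoRight => j' = j.+1
  end ->
  cell (write_move t a d) W j = if j' == W then a else cell t W j'.
Proof.
case: t => l s r; rewrite /cell; case: d => /= ->.
- case: (ltngtP j' W) => h.
  + case: (ltnP j'.+1 W) => h2.
      have -> : W - j'.+1 = (W - j'.+2).+1 by lia.
      by rewrite nth_behead.
    have -> : W - j'.+1 = 0 by lia.
    have -> : j'.+1 - W = 0 by lia.
    by rewrite nth0.
  + have -> : (j'.+1 < W) = false by lia.
    have -> : j'.+1 - W = (j' - W).+1 by lia.
    by have -> : j' - W = (j' - W).-1.+1 by lia.
  + have -> : (j'.+1 < W) = false by lia.
    by have -> : j'.+1 - W = 1 by lia.
- case: (ltngtP j' W) => h //; last by rewrite h subnn.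
  by have -> : j' - W = (j' - W).-1.+1 by lia.
- case: (ltngtP j.+1 W) => h.
  + by have -> : W - j.+1 = (W - j.+2).+1 by lia.
  + rewrite nth_head_behead; have -> : j.+1 - W = (j - W).+1 by lia.
    by [].
  + by have -> : W - j.+1 = 0 by lia.
Qed.

Lemma cell_tape_of s W j :
  cell (tape_of s) W j = if j < W then None else nth None (map Some s) (j - W).
Proof. by rewrite /cell nth_head_behead nth_nil. Qed.

Definition sym_bit (b : bool) (a : symbol) : bool :=
  if b then a == Some true else isSome a.

Lemma sym_bit_inj a a' : (forall b, sym_bit b a = sym_bit b a') -> a = a'.
Proof.
by move=> h; have := h true; have := h false; case: a a' {h} => [[]|] [[]|].
Qed.

Section Tableau.
Variables (M : machine) (T W B0 : nat).
Notation B := B0.+1.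
Notation tapes := 'I_(extra_tapes M).+1.

Definition site := (state M + tapes * 'I_B * bool)%type.

Definition bit (c : config M) (p : site) : bool :=
  match p with
  | inl s => c.1 == s
  | inr (i, j, b) => sym_bit b (cell (c.2 i) W j)
  end.

Definition local_index := (state M + tapes * bool + 'I_3 * bool)%type.

(** The state, all scanned symbols and the cells [j - 1], [j], [j + 1], as the frame may shift by
    one. Outside the window [inord] returns an arbitrary cell; [in_cone] keeps such positions out of
    the constraints. *)
Definition neighbour (p : site) (q : local_index) : site :=
  match q with
  | inl (inl s) => inl s
  | inl (inr (i, b)) => inr (i, inord W, b)
  | inr (d, b) => if p is inr (i, j, _) then inr (i, inord (j + d).-1, b) else p
  end.

(* The positions whose content at time t does not depend on the cells outside the
   window of width B. *)
Definition in_cone (t : nat) (p : site) : bool :=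
  if p is inr (_, j, _) then (t <= j) && (j + t < B) else true.

Hypotheses (TW : T <= W) (WTB : W + T < B).

Lemma in_cone_neighbour t p q :
  t < T -> in_cone t.+1 p -> in_cone t (neighbour p q).
Proof.
move=> ltT; case: q => [[s|[i b]]|[d b]] //=.
  by rewrite inordK; lia.
case: p => [s|[[i j] b']] //= h; have := ltn_ord d => ?.
by rewrite inordK; lia.
Qed.

Lemma bit_step_local p (c c' : config M) :
  in_cone 1 p -> (forall q, bit c (neighbour p q) = bit c' (neighbour p q)) ->
  bit (step c) p = bit (step c') p.
Proof.
move=> cone eqb.
have eqs : c.1 = c'.1.
  by apply/esym/eqP; have /= <- := eqb (inl (inl c.1)); rewrite eqxx.
have eqa i : scanned (c.2 i) = scanned (c'.2 i).
  apply: sym_bit_inj => b; have /= := eqb (inl (inr (i, b))).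
  by rewrite inordK ?cell_head //; lia.
have eqa' : [ffun i => scanned (c.2 i)] = [ffun i => scanned (c'.2 i)].
  by apply/ffunP => i; rewrite !ffunE.
case: p cone eqb => [s _ _|[[i j] b] /= cone eqb].
  by rewrite /step eqs eqa'; case: ifP => // _ /=; rewrite eqs.
have eqc j' : j <= j'.+1 -> j' <= j.+1 -> cell (c.2 i) W j' = cell (c'.2 i) W j'.
  move=> h1 h2; have lt3 : j'.+1 - j < 3 by lia.
  apply: sym_bit_inj => b'; have /= := eqb (inr (Ordinal lt3, b')).
  have -> : (j + (j'.+1 - j)).-1 = j' by lia.
  by rewrite inordK //; lia.
rewrite /step eqs eqa'; case: ifP => _; first by rewrite eqc.
rewrite /= !ffunE; set a := ((trans _ _).2 i).1; set d := ((trans _ _).2 i).2.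
have [j' hj'] : exists j', match d with
    | GoLeft => j = j'.+1 :> nat | Stay => j = j' :> nat | GoRight => j' = j.+1 end.
  by case: d; [exists j.-1; lia | exists j | exists j.+1].
by rewrite !(cell_write_move _ _ _ hj') eqc //; move: hj'; case: d; lia.
Qed.

Lemma bit_init s i j b : bit (init M s) (inr (i, j, b)) =
  [&& i == ord0, W <= j & if b then nth false s (j - W) else j - W < size s].
Proof.
rewrite /= ffunE cell_tape_of ltnNge; case: (leqP W j) => _ /=; last first.
  by rewrite andbF; case: b.
case: eqP => _ /=; last by rewrite nth_nil; case: b.
case: (ltnP (j - W) (size s)) => h.
  by rewrite (nth_map false) //; case: b => //=; case: nth.
by rewrite !nth_default ?size_map //; case: b.
Qed.

Definition cvar := ('I_T.+1 * site)%type.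
Definition constraint := ('I_T * site + site + unit)%type.

Definition cscope (k : constraint) (q : option local_index) : cvar :=
  match k, q with
  | inl (inl (t, p)), None => (inord t.+1, p)
  | inl (inl (t, p)), Some q => (inord t, neighbour p q)
  | inl (inr p), _ => (ord0, p)
  | inr _, _ => (ord_max, inr (ord0, inord W, true))
  end.

(* The local rules are not spelled out: a transition or an initial cell is allowed
   when it occurs in some configuration. *)
Definition cpred (l : nat) (x : word) (k : constraint)
    (a : {ffun option local_index -> bool}) : bool :=
  match k with
  | inl (inl (t, p)) => in_cone t.+1 p ==> `[< exists c : config M,
      (forall q, a (Some q) = bit c (neighbour p q)) /\ a None = bit (step c) p >]
  | inl (inr p) => `[< exists w : word,
      size w = l /\ a None = bit (init M (pair_word x w)) p >]
  | inr _ => a None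
  end.

Lemma size_pair_word x w : size (pair_word x w) = (size x).*2.+1 + size w.
Proof. by rewrite !size_cat /= size_nseq size_cat addnS addnA addnn. Qed.

Lemma nth_pair_word x w i : nth false (pair_word x w) i =
  if i < size x then true
  else if i < (size x).*2.+1 then nth false (false :: x) (i - size x)
  else nth false w (i - (size x).*2.+1).
Proof.
rewrite /pair_word nth_cat size_nseq; case: ltnP => h; first by rewrite nth_nseq h.
rewrite -cat_cons nth_cat /=; case: ltnP => h1; case: ltnP => h2 //; try lia.
by congr nth; lia.
Qed.

(** The witness is read off row 0. Fixing its length [l] fixes which initial cells are blank.
    Correctness then spreads row by row within the shrinking cone, which still contains the head
    cell [W] at time [T]. *)
Lemma tableauP (l : nat) (x : word) : W + (size x).*2.+1 + l < B ->
  (exists val : cvar -> bool,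
     forall k, cpred l x k [ffun q => val (cscope k q)]) <->
  exists w, size w = l /\
    scanned ((iter T (@step M) (init M (pair_word x w))).2 ord0) = Some true.
Proof.
move=> ltB; split=> [[val hval]|[w [szw acc]]]; last first.
  exists (fun v : cvar => bit (iter v.1 (@step M) (init M (pair_word x w))) v.2).
  case=> [[[t p]|p]|[]] /=.
  - apply/implyP => cone; apply/asboolP.
    exists (iter t (@step M) (init M (pair_word x w))); split=> [q|].
      by rewrite ffunE /= inordK //; have := ltn_ord t; lia.
    by rewrite ffunE /= inordK // ltnS ltn_ord.
  - by apply/asboolP; exists w; rewrite ffunE.
  - by rewrite ffunE /= inordK ?cell_head ?acc //; lia.
pose w := mkseq (fun j => val (ord0, inr (ord0, inord (W + (size x).*2.+1 + j), true))) l.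
have szw : size w = l by rewrite size_mkseq.
have val0 p : val (ord0, p) = bit (init M (pair_word x w)) p.
  have /asboolP[w0 [sz0]] := hval (inl (inr p)); rewrite ffunE [cscope _ _]/= => e.
  case: p e => [s|[[i j] b]] e; first by rewrite e.
  (* Only the value bits in the witness area vary with [w0], and there [w] copies [val]; every other
     initial bit is fixed by [x] and [l]. *)
  have [/and4P[/eqP i0 bT j1 j2]|out] :=
      boolP [&& i == ord0, b, W + (size x).*2.+1 <= j & j < W + (size x).*2.+1 + l].
    rewrite bit_init i0 bT nth_pair_word eqxx /=.
    have -> : W <= j by lia.
    have -> : (j - W < size x) = false by lia.
    have -> : (j - W < (size x).*2.+1) = false by lia.
    rewrite nth_mkseq; last by lia.
    by congr (val (_, inr (_, _, _))); apply: val_inj; rewrite /= inordK; lia.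
  rewrite e !bit_init; case: eqP out => //= _; case: (leqP W j) => //= Wj.
  case: b {e} => /= out; last by rewrite !size_pair_word sz0 szw.
  rewrite !nth_pair_word; case: (ltnP (j - W) (size x)) => // _.
  case: (ltnP (j - W) (size x).*2.+1) => // h.
  by rewrite !nth_default ?szw ?sz0 //; lia.
have step_ok t p : t <= T -> in_cone t p ->
    val (inord t, p) = bit (iter t (@step M) (init M (pair_word x w))) p.
  elim: t p => [|t IHt] p leT cone.
    by rewrite -val0; congr (val (_, _)); apply: val_inj; rewrite /= inordK.
  have := hval (inl (inl (Ordinal leT, p))) => /= /implyP/(_ cone)/asboolP.
  case=> c [hc]; rewrite ffunE /= => ->; apply: bit_step_local.
    by case: (p) cone => //= -[[i j] b]; lia.
  move=> q; rewrite -hc ffunE /= IHt //; first exact: ltnW.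
  exact: in_cone_neighbour.
exists w; split=> //; apply/eqP; rewrite -(cell_head _ W).
have := hval (inr tt); rewrite /= ffunE /=.
have -> : ord_max = inord T :> 'I_T.+1 by apply: val_inj; rewrite /= inordK.
by rewrite step_ok //= inordK //; lia.
Qed.

(** Among words of a fixed length, [x] matters only in the initial cells that hold the block x of
    the input 1^n 0 x w, one cell per bit. Constant answers are the case [b0 = b1]. *)
Lemma cpred_dep (n l : nat) (k : constraint) (a : {ffun option local_index -> bool}) :
  exists i b0 b1, (i < n \/ b0 = b1) /\
    forall x, size x = n -> cpred l x k a = if nth false x i then b1 else b0.
Proof.
have const (b : bool) : (forall x, size x = n -> cpred l x k a = b) ->
    exists i b0 b1, (i < n \/ b0 = b1) /\
    forall x, size x = n -> cpred l x k a = if nth false x i then b1 else b0.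
  by move=> h; exists 0, b, b; split=> [|x /h ->]; [right | case: ifP].
case: k const => [[[t p]|p]|[]] const.
- by apply: (const (cpred l [::] (inl (inl (t, p))) a)).
2: by apply: (const (a None)).
have same : (forall x x' w, size x = n -> size x' = n ->
    bit (init M (pair_word x w)) p = bit (init M (pair_word x' w)) p) ->
    forall x, size x = n ->
      cpred l x (inl (inr p)) a = cpred l (nseq n false) (inl (inr p)) a.
  move=> h x szx; congr asbool; apply: propext; split=> -[w [szw e]];
    exists w; split=> //; rewrite e; apply: h; rewrite ?size_nseq //.
case: p const same => [s|[[i j] b]] const same; first by apply: (const _ (same _)).
have [/and4P[i0 bT j1 j2]|out] := boolP [&& i == ord0, b, W + n < j & j < W + n.*2.+1].
  exists (j - (W + n).+1), (~~ a None), (a None); split; first by left; lia.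
  move=> x szx; rewrite /cpred.
  have bitE w : bit (init M (pair_word x w)) (inr (i, j, b)) = nth false x (j - (W + n).+1).
    rewrite bit_init i0 bT nth_pair_word szx.
    have -> : W <= j by lia.
    have -> : j - W < n = false by lia.
    have -> : j - W < n.*2.+1 by lia.
    by have -> : j - W - n = (j - (W + n).+1).+1 by lia.
  case: asboolP => [[w [_ ->]]|].
    by rewrite bitE; case: nth.
  move=> no; apply/esym/negbTE/negP => h; apply: no.
  exists (nseq l false); rewrite size_nseq bitE; split=> //.
  by move: h; case: (nth _ x); case: (a None).
apply: (const _ (same _)) => x x' w szx szx'; rewrite !bit_init.
case: eqP out => //= _; case: (leqP W j) => //= Wj;
  case: b {const same} => //=; last by rewrite !size_pair_word szx szx'.
rewrite !nth_pair_word szx szx' => out; case: (ltnP (j - W) n) => // h1;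
  case: (ltnP (j - W) n.*2.+1) => // h2.
have -> : j - W - n = 0 by lia.
by [].
Qed.
End Tableau.

(** * Distillation *)

Section Distillation.
Variables (T : finType) (m : nat).
Notation t := (m.*2.+1).
Variable f : {ffun 'I_t -> T} -> word.
Hypothesis size_f : forall g, size (f g) <= m.

(** Padding with blanks places all words of length at most [m] in a set of 3^m elements. *)
Definition word_code (w : word) : {ffun 'I_m -> symbol} :=
  [ffun i => nth None (map Some w) (nat_of_ord i)].

Lemma word_code_inj w w' : size w <= m -> size w' <= m ->
  word_code w = word_code w' -> w = w'.
Proof.
move=> sw sw' e; have eqn i : i < m -> nth None (map Some w) i = nth None (map Some w') i.
  by move=> lti; have /ffunP/(_ (Ordinal lti)) := e; rewrite !ffunE.
have szE : size w = size w'.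
  apply/eqP; rewrite eqn_leq; apply/andP; split; rewrite leqNgt; apply/negP => lt.
    have := eqn (size w') (leq_trans lt sw).
    by rewrite (nth_map false) // [RHS]nth_default ?size_map.
  have := eqn (size w) (leq_trans lt sw').
  by rewrite [RHS](nth_map false) // [LHS]nth_default ?size_map.
apply: (@eq_from_nth _ false) => // i lti; have := eqn i (leq_trans lti sw).
by rewrite !(nth_map false) -?szE // => -[].
Qed.

Definition inside (X : {set T}) (g : {ffun 'I_t -> T}) : bool := g \in ffun_on X.

Definition covered (X : {set T}) (z : {ffun 'I_m -> symbol}) : {set T} :=
  [set x | [exists g, [&& inside X g, word_code (f g) == z & [exists i, g i == x]]]].

(* If every output covered at most half of X, the tuples over X would number
   at most 3^m (|X|/2)^t < |X|^t. *)
Lemma heavy_output (X : {set T}) : X != set0 ->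
  exists g, inside X g /\ #|X| < 2 * #|covered X (word_code (f g))|.
Proof.
move=> X0; apply/not_existsP => none.
have small z : 2 * #|covered X z| <= #|X|.
  rewrite leqNgt; apply/negP => lt.
  have [x] : exists x, x \in covered X z.
    by apply/card_gt0P; lia.
  rewrite inE => /existsP[g /and3P[ing /eqP ez _]].
  by apply: (none g); rewrite ez.
have cardX : #|X| ^ t <= \sum_z #|covered X z| ^ t.
  have -> : #|X| ^ t = #|[set g | inside X g]|.
    by rewrite cardsE card_ffun_on card_ord.
  rewrite -sum1_card (partition_big (fun g => word_code (f g)) predT) //=.
  apply: leq_sum => z _; rewrite sum1_card -[t in X in _ <= X](card_ord t).
  rewrite -card_ffun_on; apply: subset_leq_card; apply/subsetP => g.
  rewrite !inE => /andP[]; rewrite inE => ing ez; apply/ffun_onP => i; rewrite inE.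
  by apply/existsP; exists g; rewrite ing ez; apply/existsP; exists i.
have : 2 ^ t * #|X| ^ t <= 3 ^ m * #|X| ^ t.
  apply: (@leq_trans (2 ^ t * \sum_z #|covered X z| ^ t)).
    by rewrite leq_mul2l cardX orbT.
  rewrite big_distrr /=; apply: (@leq_trans (\sum_(z : {ffun 'I_m -> symbol}) #|X| ^ t)).
    by apply: leq_sum => z _; rewrite -expnMn leq_exp2r.
  by rewrite sum_nat_const card_ffun card_option card_bool card_ord.
rewrite leq_mul2r expn_eq0 cards_eq0 (negPf X0) /= leqNgt => /negP; apply.
(* 3^m <= 4^m < 2 * 4^m = 2^(2m+1): the reason for the number of components of a tuple. *)
rewrite expnS -mul2n expnM; apply: (@leq_ltn_trans ((2 ^ 2) ^ m)).
  by case: (posnP m) => [->|m0]; rewrite ?expn0 ?leq_exp2r.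
by rewrite -[X in X < _]mul1n ltn_pmul2r // expn_gt0.
Qed.

(** Greedy choice: a heavy output covers more than half of what is left, so the remainder falls
    below the next smaller power of 2. *)
Lemma distillation (n : nat) (A : {set T}) : #|A| < 2 ^ n ->
  exists S : seq word, [/\ size S <= n,
    {in S, forall z, exists g : {ffun 'I_t -> T}, (forall i, g i \in A) /\ f g = z}
    & {in A, forall x, exists (g : {ffun 'I_t -> T}) i,
         [/\ forall i, g i \in A, g i = x & f g \in S]}].
Proof.
elim: n A => [|n IHn] A.
  rewrite ltnS leqn0 cards_eq0 => /eqP ->; exists [::].
  by split=> // x; rewrite inE.
have [->|A0] := eqVneq A set0; first by exists [::]; split=> // x; rewrite inE.
have [g [ing heavy]] := heavy_output A0.
set cov := covered A _ in heavy => ltA.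
have covA : cov \subset A.
  apply/subsetP => x; rewrite inE => /existsP[h /and3P[/ffun_onP inh _ /existsP[i /eqP<-]]].
  exact: inh.
have [|S [szS S1 S2]] := IHn (A :\: cov).
  have := cardsID cov A; have := subset_leq_card covA.
  by rewrite (setIidPr covA) expnS in ltA *; lia.
exists (f g :: S); split=> //.
- move=> z; rewrite inE => /orP[/eqP->|/S1[h [inh fh]]].
    by exists g; split=> //; exact/ffun_onP.
  by exists h; split=> // i; have := inh i; rewrite inE => /andP[].
- move=> x xA; have [|xcov] := boolP (x \in cov).
    rewrite inE => /existsP[h /and3P[/ffun_onP inh /eqP eh /existsP[i /eqP hi]]].
    exists h, i; split=> //; rewrite inE.
    by rewrite (word_code_inj _ _ eh) ?size_f ?eqxx.
  have [|h [i [inh hi fh]]] := S2 x; first by rewrite inE xcov.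
  exists h, i; split=> //; last by rewrite inE fh orbT.
  by move=> i'; have := inh i'; rewrite inE => /andP[].
Qed.

End Distillation.

(** * The verifying machine *)

Section Interpreter.
Variable MK : machine.
Notation nK := (extra_tapes MK).+1.

(* The input is a pair of a pair (x, adv) and a certificate 1^k 0 w.  The copies
   of x, adv and w are pushed to the left of the head and are therefore reversed;
   k is the position in the reversed advice at which the program starts.  A
   token is a number j < 8 written 1^j 0.  In mode [First] only 7 is accepted.
   In mode [Emit], 0 and 1 move the heads on x and w, 2 to 5 push a function of
   the scanned bit on the input tape of MK, and 6 starts MK.  In mode [Compare],
   0 and 1 are matched with the output of MK and 2 requires its end. *)
Inductive phase := CountAll | CountFst | CopyFst | CopyAdv | Seek | CopyWit.
Inductive mode := First | Emit | Compare.

Inductive control :=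
  | Phase of phase | Fetch of mode & 'I_8 | Run of state MK
  | Finish of bool | Stop of bool.

Definition phase_code (p : phase) : 'I_6 :=
  match p with
  | CountAll => inord 0 | CountFst => inord 1 | CopyFst => inord 2
  | CopyAdv => inord 3 | Seek => inord 4 | CopyWit => inord 5
  end.
Definition phase_decode (i : 'I_6) : phase :=
  nth CountAll [:: CountAll; CountFst; CopyFst; CopyAdv; Seek; CopyWit] i.
Lemma phase_codeK : cancel phase_code phase_decode.
Proof. by case; rewrite /phase_decode inordK. Qed.
HB.instance Definition _ := Finite.copy phase (can_type phase_codeK).

Definition mode_code (m : mode) : option bool :=
  match m with First => None | Emit => Some false | Compare => Some true end.
Definition mode_decode (o : option bool) : mode :=
  match o with None => First | Some false => Emit | Some true => Compare end.
Lemma mode_codeK : cancel mode_code mode_decode.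
Proof. by case. Qed.
HB.instance Definition _ := Finite.copy mode (can_type mode_codeK).

Definition control_code (c : control) :
    phase + mode * 'I_8 + state MK + bool * bool :=
  match c with
  | Phase p => inl (inl (inl p)) | Fetch m j => inl (inl (inr (m, j)))
  | Run q => inl (inr q) | Finish b => inr (false, b) | Stop b => inr (true, b)
  end.
Definition control_decode (c : phase + mode * 'I_8 + state MK + bool * bool) :=
  match c with
  | inl (inl (inl p)) => Phase p | inl (inl (inr (m, j))) => Fetch m j
  | inl (inr q) => Run q | inr (false, b) => Finish b | inr (true, b) => Stop b
  end.
Lemma control_codeK : cancel control_code control_decode.
Proof. by case. Qed.
HB.instance Definition _ := Finite.copy control (can_type control_codeK).

(* [None] leaves the tape as it is. *)
Definition action := option (symbol * direction).

Record outcome := Outcome {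
  next : control;
  act_in : action; act_all : action; act_fst : action;
  act_x : action; act_adv : action; act_wit : action;
  act_K : 'I_nK -> action
}.

Definition shift_right (s : symbol) : action := Some (s, GoRight).
Definition shift_left (s : symbol) : action := Some (s, GoLeft).
Definition push (b : bool) : action := Some (Some b, GoLeft).
Definition pop : action := Some (None, GoRight).
Definition noK : 'I_nK -> action := fun _ => None.
Definition onK (a : action) : 'I_nK -> action :=
  fun i => if i == ord0 then a else None.

Definition reject := Outcome (Finish false) None None None None None None noK.

(** The token 2 + b0 + 2 b1 yields b1 on a scanned 1 and b0 otherwise. *)
Definition token_bit (j : nat) (u : bool) : bool := if u then 4 <= j else odd j.
(* The tapes of x and w are read at the same position, x taking precedence. *)
Definition read_bit (sx sw : symbol) : bool :=
  if sx is Some b then b else sw == Some true.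

Definition interp_trans (q : control) (si sa sf sx sv sw : symbol)
    (sK : {ffun 'I_nK -> symbol}) : outcome :=
  match q with
  | Phase CountAll =>
      match si with
      | Some true =>
          Outcome q (shift_right si) (push true) None None None None noK
      | Some false =>
          Outcome (Phase CountFst) (shift_right si) (shift_right sa)
            None None None None noK
      | None => reject
      end
  | Phase CountFst =>
      match si, sa with
      | Some true, Some _ =>
          Outcome q (shift_right si) pop (push true) None None None noK
      | Some false, Some _ =>
          Outcome (Phase CopyFst) (shift_right si) pop (shift_right sf)
            None None None noK
      | _, _ => reject
      end
  | Phase CopyFst =>
      match sf, si, sa with
      | None, _, _ =>
          Outcome (Phase CopyAdv) None None None (shift_right sx) None None noK
      | Some _, Some b, Some _ =>
          Outcome q (shift_right si) pop pop (push b) None None noK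
      | _, _, _ => reject
      end
  | Phase CopyAdv =>
      match sa, si with
      | None, _ => Outcome (Phase Seek) None None None None (shift_right sv) None noK
      | Some _, Some b =>
          Outcome q (shift_right si) pop None None (push b) None noK
      | _, _ => reject
      end
  | Phase Seek =>
      match si with
      | Some true => Outcome q (shift_right si) None None None (shift_right sv) None noK
      | Some false =>
          Outcome (Phase CopyWit) (shift_right si) None None None None None noK
      | None => reject
      end
  | Phase CopyWit =>
      match si with
      | Some b => Outcome q (shift_right si) None None None None (push b) noK
      | None =>
          Outcome (Fetch First ord0) None None None None None (shift_right sw) noK
      end
  | Fetch m j =>
      match sv with
      | None => reject
      | Some true =>
          if j.+1 < 8 then
            Outcome (Fetch m (inord j.+1)) None None None None (shift_right sv) None noK
          else reject
      | Some false =>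
          match m with
          | First =>
              if j == 7 :> nat then
                Outcome (Fetch Emit ord0) None None None None (shift_right sv) None
                  (onK (push false))
              else reject
          | Emit =>
              if j == 0 :> nat then
                Outcome (Fetch Emit ord0) None None None (shift_left sx) (shift_right sv)
                  (shift_left sw) noK
              else if j == 1 :> nat then
                Outcome (Fetch Emit ord0) None None None (shift_right sx) (shift_right sv)
                  (shift_right sw) noK
              else if j < 6 then
                Outcome (Fetch Emit ord0) None None None None (shift_right sv) None
                  (onK (push (token_bit j (read_bit sx sw))))
              else if j == 6 :> nat then
                Outcome (Run (start MK)) None None None None (shift_right sv) None
                  (onK (Some (Some true, Stay)))
              else reject
          | Compare =>
              if j == 2 :> nat then
                Outcome (Finish (sK ord0 == None)) None None None None None None noK
              else if (j < 2) && (sK ord0 == Some (j == 1 :> nat)) then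
                Outcome (Fetch Compare ord0) None None None None (shift_right sv) None
                  (onK (shift_right (sK ord0)))
              else reject
          end
      end
  | Run q =>
      if halting q then
        Outcome (Fetch Compare ord0) None None None None None None noK
      else let qa := trans q sK in
        Outcome (Run qa.1) None None None None None None (fun i => Some (qa.2 i))
  | Finish b =>
      if si is Some _ then Outcome q (shift_right si) None None None None None noK
      else Outcome (Stop b) (Some (Some b, Stay)) None None None None None noK
  | Stop b => reject
  end.

Definition tape_family (A : Type) (a0 a1 a2 a3 a4 a5 : A) (k : 'I_nK -> A)
    (i : 'I_(6 + nK)) : A :=
  match split i with
  | inl j => nth a0 [:: a0; a1; a2; a3; a4; a5] j
  | inr i => k i
  end.

Definition action_on (s : symbol) (a : action) : symbol * direction :=
  if a is Some sd then sd else (s, Stay).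

Definition perform (a : action) (t : tape) : tape :=
  if a is Some (s, d) then write_move t s d else t.

Definition small_tape (j : 'I_6) : 'I_(6 + nK) := lshift nK j.

Definition interp : machine := @Machine control (5 + nK) (Phase CountAll)
  (fun q => if q is Stop _ then true else false)
  (fun q (a : {ffun 'I_(6 + nK) -> symbol}) =>
     let s k := a (small_tape (inord k)) in
     let o := interp_trans q (s 0) (s 1) (s 2) (s 3) (s 4) (s 5)
                [ffun i => a (rshift 6 i)] in
     (next o, fun i => action_on (a i)
        (tape_family (act_in o) (act_all o) (act_fst o) (act_x o) (act_adv o)
           (act_wit o) (act_K o) i))).

Definition mkc (q : control) (ti ta tf tx tv tw : tape)
    (tK : {ffun 'I_nK -> tape}) : config interp :=
  (q, [ffun i => tape_family ti ta tf tx tv tw tK i]).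

Lemma tape_family_small (A : Type) (a0 a1 a2 a3 a4 a5 : A) k (j : 'I_6) :
  tape_family a0 a1 a2 a3 a4 a5 k (small_tape j) = nth a0 [:: a0; a1; a2; a3; a4; a5] j.
Proof. by rewrite /tape_family /small_tape -[lshift _ _]/(unsplit (inl j)) unsplitK. Qed.

Lemma tape_family_K (A : Type) (a0 a1 a2 a3 a4 a5 : A) k (i : 'I_nK) :
  tape_family a0 a1 a2 a3 a4 a5 k (rshift 6 i) = k i.
Proof. by rewrite /tape_family -[rshift _ _]/(unsplit (inr i)) unsplitK. Qed.

Lemma do_action_on a t :
  write_move t (action_on (scanned t) a).1 (action_on (scanned t) a).2 = perform a t.
Proof. by case: a => [[s d]|] //=; case: t. Qed.

Lemma step_mkc q ti ta tf tx tv tw tK :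
  ~~ (if q is Stop _ then true else false) ->
  step (mkc q ti ta tf tx tv tw tK) =
  let o := interp_trans q (scanned ti) (scanned ta) (scanned tf) (scanned tx)
             (scanned tv) (scanned tw) [ffun i => scanned (tK i)] in
  mkc (next o) (perform (act_in o) ti) (perform (act_all o) ta) (perform (act_fst o) tf)
    (perform (act_x o) tx) (perform (act_adv o) tv) (perform (act_wit o) tw)
    [ffun i => perform (act_K o i) (tK i)].
Proof.
move=> nstop; rewrite /step [halting _]/= (negPf nstop).
have eK : [ffun i => [ffun i0 : 'I_(6 + nK) => scanned ((mkc q ti ta tf tx tv tw tK).2 i0)]
             (rshift 6 i)] = [ffun i => scanned (tK i)].
  by apply/ffunP => i; rewrite !ffunE tape_family_K.
rewrite [trans _ _]/= eK !ffunE !tape_family_small !inordK //=.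
set o := interp_trans _ _ _ _ _ _ _ _; congr pair; apply/ffunP => i; rewrite !ffunE.
rewrite do_action_on /tape_family; case: (split (i : 'I_(6 + nK))) => [[[|[|[|[|[|[|k]]]]]] ltk]|i'] //=.
by rewrite ffunE.
Qed.

End Interpreter.

Arguments noK : simpl never.
Arguments onK : simpl never.

(** * Verdict and running time of the verifying machine *)

Section InterpreterRun.
Variables (MK : machine) (timeK : nat -> nat).
Notation nK := (extra_tapes MK).+1.
Notation IM := (interp MK).
Notation mkc := (@mkc MK).
Notation Fetch := (@Fetch MK).
Notation Finish := (@Finish MK).
Notation Phase := (@Phase MK).

Definition stack (l : seq symbol) (w : word) : tape :=
  Tape l (head None (map Some w)) (behead (map Some w)).

Definition pushed (w : word) : tape := Tape [::] None (map Some w).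

Definition move_right (t : tape) : tape := write_move t (scanned t) GoRight.
Definition move_left (t : tape) : tape := write_move t (scanned t) GoLeft.

Definition kernel_tape (w : word) : tape :=
  (iter (timeK (size w)) (@step MK) (init MK w)).2 ord0.

(* The verdict of the machine as a function of its tapes, phase by phase. *)
Fixpoint sem_compare (v : word) (j : nat) (t : tape) : bool :=
  match v with
  | [::] => false
  | true :: v' => (j.+1 < 8) && sem_compare v' j.+1 t
  | false :: v' =>
      if j == 2 then scanned t == None
      else [&& j < 2, scanned t == Some (j == 1) & sem_compare v' 0 (move_right t)]
  end.

Fixpoint sem_emit (v : word) (j : nat) (tx tw : tape) (acc : word) : bool :=
  match v with
  | [::] => false
  | true :: v' => (j.+1 < 8) && sem_emit v' j.+1 tx tw acc
  | false :: v' =>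
      if j == 0 then sem_emit v' 0 (move_left tx) (move_left tw) acc
      else if j == 1 then sem_emit v' 0 (move_right tx) (move_right tw) acc
      else if j < 6 then
        sem_emit v' 0 tx tw
          (token_bit j (read_bit (scanned tx) (scanned tw)) :: acc)
      else (j == 6) && sem_compare v' 0 (kernel_tape (true :: acc))
  end.

Fixpoint sem_first (v : word) (j : nat) (tx tw : tape) : bool :=
  match v with
  | [::] => false
  | true :: v' => (j.+1 < 8) && sem_first v' j.+1 tx tw
  | false :: v' => (j == 7) && sem_emit v' 0 tx tw [:: false]
  end.

Fixpoint sem_witness (lx : seq symbol) (s x v w : word) : bool :=
  if s is b :: s' then sem_witness lx s' x v (b :: w)
  else sem_first v 0 (stack lx x) (stack [:: None] w).

Fixpoint sem_seek (lx : seq symbol) (s x v : word) : bool :=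
  match s with
  | true :: s' => sem_seek lx s' x (behead v)
  | false :: s' => sem_witness lx s' x v [::]
  | [::] => false
  end.

Fixpoint sem_advice (lx : seq symbol) (s : word) (a : nat) (x v : word) : bool :=
  match a, s with
  | 0, _ => sem_seek lx s x v
  | a'.+1, b :: s' => sem_advice lx s' a' x (b :: v)
  | _, _ => false
  end.

Fixpoint sem_copy (s : word) (a f : nat) (x : word) : bool :=
  match f, s, a with
  | 0, _, _ => sem_advice [:: None] s a x [::]
  | f'.+1, b :: s', a'.+1 => sem_copy s' a' f' (b :: x)
  | _, _, _ => false
  end.

Fixpoint sem_fst (s : word) (a f : nat) : bool :=
  match s, a with
  | true :: s', a'.+1 => sem_fst s' a' f.+1
  | false :: s', a'.+1 => sem_copy s' a' f [::]
  | _, _ => false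
  end.

Fixpoint sem_all (s : word) (a : nat) : bool :=
  match s with
  | true :: s' => sem_all s' a.+1
  | false :: s' => sem_fst s' a 0
  | [::] => false
  end.

Definition runs (c : config IM) (b : bool) (n : nat) : Prop :=
  exists k, [/\ k <= n, halting (iter k (@step IM) c).1
              & output (iter k (@step IM) c) = [:: b]].

Lemma runs_le c b n n' : n <= n' -> runs c b n -> runs c b n'.
Proof. by move=> le_nn' [k [lek hk ok]]; exists k; rewrite (leq_trans lek). Qed.

Lemma runs_step c b n : 0 < n -> runs (step c) b n.-1 -> runs c b n.
Proof. by move=> n0 [k [lek hk ok]]; exists k.+1; rewrite iterSr -(prednK n0). Qed.

Lemma do_noK (tK : {ffun 'I_nK -> tape}) :
  [ffun i => perform (@noK MK i) (tK i)] = tK :> {ffun 'I_nK -> tape}.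
Proof. by apply/ffunP => i; rewrite ffunE. Qed.

Lemma tape_family_in (A : Type) (a0 a1 a2 a3 a4 a5 : A) k :
  tape_family a0 a1 a2 a3 a4 a5 k (ord0 : 'I_(5 + nK).+1) = a0.
Proof.
have -> : ord0 = small_tape MK ord0 by apply: val_inj.
by rewrite tape_family_small.
Qed.

(** The verdict is written on the blank after the input, where nothing follows it, so that the
    output is a single bit. *)
Lemma runs_finish b l s ta tf tx tv tw tK :
  runs (mkc (Finish b) (stack l s) ta tf tx tv tw tK) b (size s).+1.
Proof.
elim: s l => [|c s IHs] l.
  apply: runs_step; rewrite ?addn_gt0 ?orbT // step_mkc //= ?do_noK; exists 0; split=> //=.
  by rewrite /output /= ffunE tape_family_in.
by apply: runs_step; rewrite ?addn_gt0 ?orbT // step_mkc //= ?do_noK; exact: IHs.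
Qed.

Lemma runs_reject li ta tf tx tv tw tK n : 0 < n ->
  runs (mkc (Finish false) (stack li [::]) ta tf tx tv tw tK) false n.
Proof. by move=> n0; apply: runs_le n0 _; exact: (runs_finish _ _ [::]). Qed.

Lemma runs_compare (v : word) j l li ta tf tx tw tK : j < 8 ->
  runs (mkc (Fetch Compare (inord j)) (stack li [::]) ta tf tx (stack l v) tw tK)
    (sem_compare v j (tK ord0)) (size v).+2.
Proof.
elim: v j l tK => [|[] v IHv] j l tK ltj; apply: runs_step; rewrite ?addn_gt0 ?orbT //;
  rewrite step_mkc //= ?do_noK ?inordK // ?ffunE.
- exact: runs_reject.
- case: ifP => lt1 /=; rewrite ?do_noK; first exact: IHv.
  exact: runs_reject.
- case: eqP => _ /=; rewrite ?do_noK.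
    by apply: runs_le (runs_finish _ _ [::] _ _ _ _ _ _).
  case: (j < 2) => /=; rewrite ?do_noK; last exact: runs_reject.
  case: (scanned (tK ord0) == _) => /=; rewrite ?do_noK;
    last exact: runs_reject.
  have -> : ord0 = inord 0 :> 'I_8 by apply: val_inj; rewrite /= inordK.
  set tK' := [ffun _ => _].
  have -> : move_right (tK ord0) = tK' ord0 by rewrite ffunE.
  exact: IHv.
Qed.

Lemma runs_kernel T b n (c : config MK) ti ta tf tx tv tw :
  halting (iter T (@step MK) c).1 ->
  runs (mkc (Fetch Compare ord0) ti ta tf tx tv tw (iter T (@step MK) c).2) b n ->
  runs (mkc (Run c.1) ti ta tf tx tv tw c.2) b (T + n.+1).
Proof.
elim: T c => [|T IHT] c.
  move=> /= hc hr; apply: runs_step; rewrite ?addn_gt0 ?orbT // step_mkc //= ?do_noK hc /=.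
  congr (runs (mkc _ _ _ _ _ _ _ _) _ _): hr.
  by apply/ffunP => i; rewrite ffunE.
rewrite iterSr => hc hr; have [h|nh] := boolP (halting c.1).
  apply: (@runs_le _ _ (T + n.+1)); first by rewrite leq_add2r.
  by apply: IHT; move: hc hr; rewrite /step h.
apply: runs_step; rewrite ?addn_gt0 ?orbT // step_mkc //= ?do_noK (negPf nh) /=.
have := IHT _ hc hr; congr (runs (mkc _ _ _ _ _ _ _ _) _ _).
  by rewrite /step (negPf nh).
by rewrite /step (negPf nh); apply/ffunP => i; rewrite !ffunE /=; case: ((trans _ _).2 i).
Qed.

Definition emitted (acc : word) : {ffun 'I_nK -> tape} :=
  [ffun i => if i == ord0 then pushed acc else tape_of [::]].

Lemma do_onK a acc :
  [ffun i => perform (onK a i) (emitted acc i)] =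
  [ffun i => if i == ord0 then perform a (pushed acc) else tape_of [::]]
  :> {ffun 'I_nK -> tape}.
Proof. by apply/ffunP => i; rewrite !ffunE /onK; case: eqP. Qed.

Hypothesis timeK_mono : forall a b, a <= b -> timeK a <= timeK b.
Hypothesis haltK : forall w : word, false \in w ->
  halting (iter (timeK (size w)) (@step MK) (init MK w)).1.

(** The accumulator always contains the 0 pushed by token 7, which makes [haltK] applicable whatever
    the program does. Each pushed bit uses up at least one bit of [v], hence the bound on the input
    of [MK]. *)
Lemma runs_emit (v : word) j l li ta tf tx tw (acc : word) : j < 8 -> false \in acc ->
  runs (mkc (Fetch Emit (inord j)) (stack li [::]) ta tf tx (stack l v) tw (emitted acc))
    (sem_emit v j tx tw acc) (size v + timeK (size acc + size v) + 4).
Proof.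
have e0 : ord0 = inord 0 :> 'I_8 by apply: val_inj; rewrite /= inordK.
elim: v j l tx tw acc => [|[] v IHv] j l tx tw acc ltj facc;
  apply: runs_step; rewrite ?addn_gt0 ?orbT // step_mkc //= ?do_noK ?inordK //.
- apply: runs_reject; lia.
- case: ifP => lt1 /=; last by apply: runs_reject; lia.
  rewrite do_noK; apply: runs_le (IHv j.+1 _ _ _ _ _ _) => //.
  by have : timeK (size acc + size v) <= timeK (size acc + (size v).+1)
    by [apply: timeK_mono; lia]; lia.
have mono : timeK (size acc + size v) <= timeK (size acc + (size v).+1).
  by apply: timeK_mono; lia.
case: eqP => _ /=.
  by rewrite do_noK e0; apply: runs_le (IHv 0 _ _ _ _ _ _) => //; lia.
case: eqP => _ /=.
  by rewrite do_noK e0; apply: runs_le (IHv 0 _ _ _ _ _ _) => //; lia.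
case: ltnP => _ /=.
  rewrite do_onK e0; set b := token_bit _ _.
  have -> : [ffun i : 'I_nK => if i == ord0 then perform (push b) (pushed acc) else tape_of [::]]
      = emitted (b :: acc) by apply/ffunP => i; rewrite !ffunE.
  apply: runs_le (IHv 0 _ _ _ (b :: acc) _ _) => //; last by rewrite inE facc orbT.
  by rewrite /= addSnnS.
case: eqP => _ /=; last by apply: runs_reject; lia.
have -> : [ffun i => perform (onK (Some (Some true, Stay)) i) (emitted acc i)]
    = (init MK (true :: acc)).2 by rewrite do_onK; apply/ffunP => i; rewrite !ffunE; case: eqP.
apply: (@runs_le _ _ (timeK (size acc).+1 + (size v).+3)).
  by have : timeK (size acc).+1 <= timeK (size acc + (size v).+1)
    by [apply: timeK_mono; lia]; lia.
apply: (@runs_kernel _ _ _ (init MK (true :: acc))).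
  by apply: (haltK (w := true :: acc)); rewrite inE.
by rewrite e0; exact: runs_compare.
Qed.

Lemma runs_first (v : word) j l li ta tf tx tw : j < 8 ->
  runs (mkc (Fetch First (inord j)) (stack li [::]) ta tf tx (stack l v) tw (emitted [::]))
    (sem_first v j tx tw) (size v + timeK (size v) + 4).
Proof.
have e0 : ord0 = inord 0 :> 'I_8 by apply: val_inj; rewrite /= inordK.
elim: v j l => [|[] v IHv] j l ltj; apply: runs_step; rewrite ?addn_gt0 ?orbT //;
  rewrite step_mkc //= ?do_noK ?inordK //.
- apply: runs_reject; lia.
- case: ifP => lt1 /=; last by apply: runs_reject; lia.
  rewrite do_noK; apply: runs_le (IHv j.+1 _ _) => //.
  by have : timeK (size v) <= timeK (size v).+1 by [apply: timeK_mono; lia]; lia.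
case: eqP => _ /=; last by apply: runs_reject; lia.
rewrite do_onK e0.
have -> : [ffun i : 'I_nK => if i == ord0 then perform (push false) (pushed [::]) else tape_of [::]]
    = emitted [:: false] by apply/ffunP => i; rewrite !ffunE.
exact: runs_emit.
Qed.

Variable N : nat.
Definition fetch_time : nat := N + timeK N + 4.

Lemma runs_abort l s ta tf tx tv tw tK n : size s < n ->
  runs (mkc (Finish false) (stack l s) ta tf tx tv tw tK) false n.
Proof. by move=> ltn; apply: runs_le ltn _; exact: runs_finish. Qed.

Lemma runs_witness (s x v w : word) l la ta tf lx : size v <= N ->
  runs (mkc (Phase CopyWit) (stack l s) ta tf (stack lx x) (stack la v)
          (pushed w) (emitted [::]))
    (sem_witness lx s x v w) (size s + fetch_time + 1).
Proof.
move=> leN; elim: s w l => [|b s IHs] w l; apply: runs_step;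
  rewrite ?addn_gt0 ?orbT // step_mkc //= do_noK; last first.
  by apply: runs_le (IHs (b :: w) _); lia.
have -> : ord0 = inord 0 :> 'I_8 by apply: val_inj; rewrite /= inordK.
apply: runs_le (@runs_first v 0 _ _ _ _ _ _ _) => //.
by have := timeK_mono leN; rewrite /fetch_time; lia.
Qed.

Lemma runs_seek (s x v : word) l la ta tf lx : size v <= N ->
  runs (mkc (Phase Seek) (stack l s) ta tf (stack lx x) (stack la v)
          (pushed [::]) (emitted [::]))
    (sem_seek lx s x v) (size s + fetch_time + 2).
Proof.
elim: s v l la => [|[] s IHs] v l la leN; apply: runs_step;
  rewrite ?addn_gt0 ?orbT // step_mkc //= do_noK.
- by apply: (@runs_abort _ [::]); rewrite /fetch_time /=; lia.
- case: v leN => [|b v] leN /=.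
    by apply: runs_le (IHs [::] _ _ _); lia.
  by apply: runs_le (IHs v _ _ _); move: leN => /=; lia.
- by apply: runs_le (runs_witness _ _ _ _ _ _ _ _ leN); lia.
Qed.

Lemma runs_advice (s x v : word) a l la tf lx : size s + size v <= N ->
  runs (mkc (Phase CopyAdv) (stack l s) (stack la (nseq a true)) tf (stack lx x)
          (pushed v) (pushed [::]) (emitted [::]))
    (sem_advice lx s a x v) (size s + fetch_time + 3).
Proof.
elim: a s v l la => [|a IHa] s v l la leN; apply: runs_step;
  rewrite ?addn_gt0 ?orbT // step_mkc //=.
  have -> : sem_advice lx s 0 x v = sem_seek lx s x v by case: (s).
  by rewrite do_noK; apply: runs_le (@runs_seek s x v _ _ _ _ _ _); lia.
case: s leN => [|b s] leN /=; rewrite do_noK.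
  by apply: (@runs_abort _ [::]); rewrite /fetch_time /=; lia.
by apply: runs_le (IHa s (b :: v) _ _ _); move: leN => /=; lia.
Qed.

Lemma runs_copy (s x : word) a f l la lf : size s <= N ->
  runs (mkc (Phase CopyFst) (stack l s) (stack la (nseq a true))
          (stack lf (nseq f true)) (pushed x) (pushed [::]) (pushed [::]) (emitted [::]))
    (sem_copy s a f x) (size s + fetch_time + 4).
Proof.
elim: f s a x l la lf => [|f IHf] s a x l la lf leN; apply: runs_step;
  rewrite ?addn_gt0 ?orbT // step_mkc //=.
  have -> : sem_copy s a 0 x = sem_advice [:: None] s a x [::] by case: (s).
  rewrite do_noK; apply: runs_le (@runs_advice s x [::] a _ _ _ _ _); first by lia.
  by rewrite addn0.
case: s leN => [|b s] leN; rewrite /= ?do_noK.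
  by apply: (@runs_abort _ [::]); rewrite /fetch_time /=; lia.
case: a => [|a] /=; rewrite do_noK.
  by apply: (@runs_abort _ (b :: s)); rewrite /fetch_time /=; lia.
by apply: runs_le (IHf s a (b :: x) _ _ _ _); move: leN => /=; lia.
Qed.

Lemma runs_fst (s : word) a f l la : size s <= N ->
  runs (mkc (Phase CountFst) (stack l s) (stack la (nseq a true))
          (pushed (nseq f true)) (pushed [::]) (pushed [::]) (pushed [::]) (emitted [::]))
    (sem_fst s a f) (size s + fetch_time + 5).
Proof.
elim: s a f l la => [|b s IHs] a f l la leN; apply: runs_step;
  rewrite ?addn_gt0 ?orbT // step_mkc //=.
  by case: a => [|a] /=; rewrite do_noK;
    apply: (@runs_abort _ [::]); rewrite /fetch_time /=; lia.
move: leN => /= leN.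
case: b; case: a => [|a] /=; rewrite do_noK;
  try by apply: (@runs_abort _ (_ :: s)); rewrite /fetch_time /=; lia.
  by apply: runs_le (IHs a f.+1 _ _ _); lia.
by apply: runs_le (@runs_copy s [::] a f _ _ _ _); lia.
Qed.

Lemma runs_all (s : word) a l : size s <= N ->
  runs (mkc (Phase CountAll) (stack l s) (pushed (nseq a true))
          (pushed [::]) (pushed [::]) (pushed [::]) (pushed [::]) (emitted [::]))
    (sem_all s a) (size s + fetch_time + 6).
Proof.
elim: s a l => [|[] s IHs] a l /= leN; apply: runs_step;
  rewrite ?addn_gt0 ?orbT // step_mkc //= do_noK.
- by apply: (@runs_abort _ [::]); rewrite /fetch_time /=; lia.
- by apply: runs_le (IHs a.+1 _ _); lia.
- by apply: runs_le (@runs_fst s a 0 _ _ _); lia.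
Qed.

Lemma init_interp (s : word) : init IM s =
  mkc (Phase CountAll) (stack [::] s) (pushed [::]) (pushed [::])
    (pushed [::]) (pushed [::]) (pushed [::]) (emitted [::]).
Proof.
congr pair; apply/ffunP => i; rewrite !ffunE.
case: (split_ordP (i : 'I_(6 + nK))) => j ->.
  rewrite -[lshift _ _]/(small_tape MK j) tape_family_small.
  by case: j => -[|[|[|[|[|[|k]]]]]] ltk.
rewrite tape_family_K ffunE; case: (j == ord0); last by case: eqP.
by case: eqP.
Qed.

Lemma interp_halts (s : word) : size s <= N ->
  halts_within IM s [:: sem_all s 0] (N + fetch_time + 6).
Proof.
move=> leN; have [k [lek hk ok]] := @runs_all s 0 [::] leN.
rewrite /halts_within init_interp.
have -> : N + fetch_time + 6 = (N + fetch_time + 6 - k) + k by lia.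
rewrite iterD; elim: (_ - _) => [|n [hn on]] //=.
by rewrite /step hn.
Qed.

End InterpreterRun.

(** * Advice programs *)

Section Programs.
Variables (MK : machine) (timeK : nat -> nat).
Notation sem_emit := (@sem_emit MK timeK).
Notation sem_first := (@sem_first MK timeK).
Notation sem_witness := (@sem_witness MK timeK).
Notation sem_seek := (@sem_seek MK timeK).
Notation sem_advice := (@sem_advice MK timeK).
Notation sem_copy := (@sem_copy MK timeK).
Notation sem_fst := (@sem_fst MK timeK).
Notation sem_all := (@sem_all MK timeK).

Lemma sem_all_unary n s a : sem_all (unary n ++ false :: s) a = sem_fst s (n + a) 0.
Proof. by elim: n a => [|n IHn] a //=; rewrite IHn addSnnS. Qed.

Lemma sem_fst_unary n s a f :
  sem_fst (unary n ++ false :: s) (n + a.+1) f = sem_copy s a (n + f) [::].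
Proof. by elim: n f => [|n IHn] f //=; rewrite IHn addSnnS. Qed.

Lemma sem_copy_cat x s a y :
  sem_copy (x ++ s) (size x + a) (size x) y = sem_advice [:: None] s a (rev x ++ y) [::].
Proof.
elim: x y => [|b x IHx] y /=; first by case: s.
by rewrite IHx rev_cons cat_rcons.
Qed.

Lemma sem_advice_cat lx adv s x v :
  sem_advice lx (adv ++ s) (size adv) x v = sem_seek lx s x (rev adv ++ v).
Proof.
elim: adv v => [|b adv IH] v /=; first by case: s.
by rewrite IH rev_cons cat_rcons.
Qed.

Lemma sem_witnessE lx w x v w0 :
  sem_witness lx w x v w0 = sem_first v 0 (stack lx x) (stack [:: None] (rev w ++ w0)).
Proof. by elim: w w0 => [|b w IHw] w0 //=; rewrite IHw rev_cons cat_rcons. Qed.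

Lemma sem_seekP lx s x v : sem_seek lx s x v <->
  exists k w, s = unary k ++ false :: w /\
    sem_first (drop k v) 0 (stack lx x) (stack [:: None] (rev w)).
Proof.
elim: s v => [|[] s IHs] v /=.
- by split=> // -[[|k] [w []]].
- rewrite IHs -drop1; split=> [[k [w [-> h]]]|[[|k] [w [//= [->]]]]].
    by exists k.+1, w; rewrite drop_drop addn1 in h *.
  by move=> h; exists k, w; rewrite drop_drop addn1.
- rewrite sem_witnessE cats0; split=> [h|[[|k] [w [//= [->]]]]].
    by exists 0, s; rewrite drop0.
  by rewrite drop0.
Qed.

Lemma sem_all_pairP x adv c : sem_all (pair_word (pair_word x adv) c) 0 <->
  exists k w, c = unary k ++ false :: w /\
    sem_first (drop k (rev adv)) 0 (stack [:: None] (rev x)) (stack [:: None] (rev w)).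
Proof.
rewrite -sem_seekP {1}/pair_word sem_all_unary addn0 size_pair_word.
rewrite {1}/pair_word -?catA cat_cons -catA.
(* The counter holds the length of the whole pair. The header uses up |x| + 1 of it and the copy of
   [x] another |x|; the remaining |adv| marks the end of the advice. *)
have -> : (size x).*2.+1 + size adv = size x + (size x + size adv).+1 by lia.
rewrite sem_fst_unary addn0 -?catA.
by rewrite sem_copy_cat sem_advice_cat !cats0.
Qed.

Definition token (j : nat) : word := nseq j true ++ [:: false].
Definition code (ts : seq nat) : word := flatten (map token ts).

Lemma code_cons j ts v : code (j :: ts) ++ v = nseq j true ++ false :: (code ts ++ v).
Proof. by rewrite /code /= -!catA. Qed.

Lemma sem_compare_true k v j t : j + k < 8 ->
  sem_compare (nseq k true ++ v) j t = sem_compare v (j + k) t.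
Proof.
elim: k j => [|k IHk] j /=; first by rewrite addn0.
by move=> h; rewrite IHk; [rewrite addSnnS andb_idl //; lia | lia].
Qed.

Lemma sem_emit_true k v j tx tw acc : j + k < 8 ->
  sem_emit (nseq k true ++ v) j tx tw acc = sem_emit v (j + k) tx tw acc.
Proof.
elim: k j => [|k IHk] j /=; first by rewrite addn0.
by move=> h; rewrite IHk; [rewrite addSnnS andb_idl //; lia | lia].
Qed.

Lemma sem_first_true k v j tx tw : j + k < 8 ->
  sem_first (nseq k true ++ v) j tx tw = sem_first v (j + k) tx tw.
Proof.
elim: k j => [|k IHk] j /=; first by rewrite addn0.
by move=> h; rewrite IHk; [rewrite addSnnS andb_idl //; lia | lia].
Qed.

Lemma until_blank_move_right t :
  until_blank (scanned (move_right t) :: right_cells (move_right t)) =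
  until_blank (right_cells t).
Proof. by case: t => l s [|a r]. Qed.

Lemma sem_compare_code z v t :
  sem_compare (code (map nat_of_bool z ++ [:: 2]) ++ v) 0 t =
  (until_blank (scanned t :: right_cells t) == z).
Proof.
elim: z t => [|b z IHz] t.
  by rewrite cat0s code_cons sem_compare_true //=; case: (scanned t).
rewrite map_cons cat_cons code_cons sem_compare_true; last by case: b.
rewrite [LHS]/= IHz until_blank_move_right; case: t => l [c|] r; last by case: b.
by rewrite [until_blank _]/= eqseq_cons; case: b; case: c.
Qed.

Lemma cell_move_right t W j p :
  cell (iter p move_right t) W j = cell t W (j + p).
Proof.
elim: p j => [|p IHp] j; first by rewrite addn0.
rewrite iterS (@cell_write_move _ _ GoRight _ _ j.+1) // IHp addSnnS.
by case: eqP => // e; rewrite -(cell_head _ W) IHp -e addSnnS.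
Qed.

Lemma cell_move_left t W j p : p <= j ->
  cell (iter p move_left t) W j = cell t W (j - p).
Proof.
elim: p j => [j _|p IHp [//|j] lepj]; first by rewrite subn0.
 rewrite iterS (@cell_write_move _ _ GoLeft _ _ j) // IHp // subSS.
by case: eqP => // e; rewrite -(cell_head _ W) IHp -?e.
Qed.

(** Stated cell by cell because an excursion beyond the end of the word leaves explicit blanks
    behind and does not restore the tape as a record. *)
Definition holds (t : tape) (u : word) : Prop :=
  forall i, nth None (scanned t :: right_cells t) i = nth None (map Some u) i.

Lemma cell_right t W i : cell t W (W + i) = nth None (scanned t :: right_cells t) i.
Proof. by rewrite /cell ltnNge leq_addr /= addnC addnK. Qed.

Lemma holds_stack l u : holds (stack l u) u.
Proof. by move=> i; exact: (nth_head_behead None (map Some u) i). Qed.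

Lemma holds_scanned t u p : holds t u ->
  scanned (iter p move_right t) = nth None (map Some u) p.
Proof. by move=> h; rewrite -(cell_head _ 0) cell_move_right cell_right h. Qed.

Lemma holds_round_trip t u p : holds t u ->
  holds (iter p move_left (iter p move_right t)) u.
Proof.
move=> h i; rewrite -(cell_right _ p) cell_move_left ?leq_addr // cell_move_right.
by rewrite -addnBAC // subnn add0n addnC cell_right h.
Qed.

Definition bit_spec := (nat * bool * bool)%type.

Definition spec_token (s : bit_spec) : nat := 2 + s.1.2 + 2 * s.2.

Definition spec_program (s : bit_spec) : seq nat :=
  nseq s.1.1 1 ++ spec_token s :: nseq s.1.1 0.

(* A specification (p, b0, b1) yields b1 or b0 according to the bit at position p
   of u, or of w if u is too short. *)
Definition spec_value (u w : word) (s : bit_spec) : bool :=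
  if (if s.1.1 < size u then nth false u s.1.1 else nth false w s.1.1)
  then s.2 else s.1.2.

Lemma sem_emit_right p v tx tw acc :
  sem_emit (code (nseq p 1) ++ v) 0 tx tw acc =
  sem_emit v 0 (iter p move_right tx) (iter p move_right tw) acc.
Proof.
elim: p tx tw => [|p IHp] tx tw //.
by rewrite [nseq _ _]/= code_cons sem_emit_true // [LHS]/= IHp -!iterSr.
Qed.

Lemma sem_emit_left p v tx tw acc :
  sem_emit (code (nseq p 0) ++ v) 0 tx tw acc =
  sem_emit v 0 (iter p move_left tx) (iter p move_left tw) acc.
Proof.
elim: p tx tw => [|p IHp] tx tw //.
by rewrite [nseq _ _]/= code_cons sem_emit_true // [LHS]/= IHp -!iterSr.
Qed.

Lemma code_cat ts ts' : code (ts ++ ts') = code ts ++ code ts'.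
Proof. by rewrite /code map_cat flatten_cat. Qed.

Lemma read_bit_nth u w p :
  read_bit (nth None (map Some u) p) (nth None (map Some w) p) =
  if p < size u then nth false u p else nth false w p.
Proof.
case: ltnP => h; first by rewrite (nth_map false).
rewrite [nth None (map Some u) p]nth_default ?size_map //=.
have [h2|h2] := ltnP p (size w); first by rewrite (nth_map false) //; case: nth.
by rewrite !nth_default ?size_map.
Qed.

Lemma sem_emit_spec s v tx tw u w acc : holds tx u -> holds tw w ->
  exists tx' tw', [/\ holds tx' u, holds tw' w &
    sem_emit (code (spec_program s) ++ v) 0 tx tw acc =
    sem_emit v 0 tx' tw' (spec_value u w s :: acc)].
Proof.
case: s => -[p b0] b1 hx hw.
exists (iter p move_left (iter p move_right tx)).
exists (iter p move_left (iter p move_right tw)).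
split; [exact: holds_round_trip|exact: holds_round_trip|].
rewrite /spec_program code_cat -catA sem_emit_right code_cons.
have [j ej] : exists j, j = spec_token (p, b0, b1) by exists (spec_token (p, b0, b1)).
have lt_j : 2 <= j < 6 by rewrite ej /spec_token /=; case: (b0) (b1) => [] [].
rewrite -ej.
rewrite sem_emit_true; last by lia.
rewrite [LHS]/= add0n; have -> : (j == 0) = false by lia.
have -> : (j == 1) = false by lia.
have -> : j < 6 by lia.
rewrite sem_emit_left (holds_scanned _ hx) (holds_scanned _ hw) read_bit_nth.
congr (sem_emit _ _ _ _ (_ :: _)); rewrite ej /token_bit /spec_value /spec_token /=.
by case: ifP => _; case: (b0) (b1) => [] [].
Qed.

Definition entry (specs : seq bit_spec) (z : word) : seq nat :=
  flatten (map spec_program specs) ++ 6 :: map nat_of_bool z ++ [:: 2].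

Lemma sem_emit_entry specs z v tx tw u w acc : holds tx u -> holds tw w ->
  sem_emit (code (entry specs z) ++ v) 0 tx tw acc =
  (let t := kernel_tape MK timeK (true :: rev (map (spec_value u w) specs) ++ acc) in
   until_blank (scanned t :: right_cells t) == z).
Proof.
elim: specs tx tw acc => [|s specs IH] tx tw acc hx hw.
  by rewrite /entry cat0s code_cons sem_emit_true //= sem_compare_code.
have [tx' [tw' [hx' hw' e]]] :=
  sem_emit_spec s (code (entry specs z) ++ v) acc hx hw.
rewrite /entry /= -catA code_cat -catA e IH //.
by rewrite rev_cons cat_rcons.
Qed.

Lemma sem_firstP v j tx tw : j < 8 -> sem_first v j tx tw ->
  exists v', v = nseq (7 - j) true ++ false :: v' /\ sem_emit v' 0 tx tw [:: false].
Proof.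
elim: v j => [|[] v IHv] j ltj //=.
  case/andP=> ltj1 /(IHv _ ltj1)[v' [-> h]]; exists v'; split=> //.
  by have -> : 7 - j = (7 - j.+1).+1 by lia.
by case/andP=> /eqP -> h; exists v.
Qed.

End Programs.

(** * Entry points of the advice *)

Definition advice_code (entries : seq (seq nat)) : word :=
  code (flatten [seq 7 :: e | e <- entries]).

(* Token 7 is the longest one and occurs only at the start of an entry, so that a
   program can be entered only there. *)
Lemma drop_code_start (ts : seq nat) k v : {in ts, forall j, j < 8} ->
  drop k (code ts) = nseq 7 true ++ false :: v ->
  exists ts1 ts2, ts = ts1 ++ 7 :: ts2 /\ v = code ts2.
Proof.
elim: ts k => [|j ts IHts] k ltts; first by case: k.
have ltj : j < 8 by apply: ltts; rewrite mem_head.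
have ltts' : {in ts, forall j, j < 8} by move=> i it; apply: ltts; rewrite inE it orbT.
rewrite -[code _]cats0 code_cons cats0.
have [lekj|ltjk] := leqP k j; last first.
  have -> : k = (k - j.+1).+1 + j by lia.
  rewrite -drop_drop drop_size_cat ?size_nseq //= => /(IHts _ ltts')[ts1 [ts2 [-> ->]]].
  by exists (j :: ts1), ts2.
rewrite drop_cat size_nseq ltn_neqAle lekj andbT; case: eqVneq => [->|nkj] /=.
  by rewrite subnn.
rewrite drop_nseq => e; have [ej <-] := @unary_sep_inj (j - k) 7 _ _ e.
have ej7 : j = 7 by lia.
by exists [::], ts; rewrite ej7.
Qed.

Lemma start_split (entries : seq (seq nat)) ts1 ts2 :
  {in entries, forall e, 7 \notin e} ->
  flatten [seq 7 :: e | e <- entries] = ts1 ++ 7 :: ts2 ->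
  exists e rest, e \in entries /\ ts2 = e ++ rest.
Proof.
elim: entries ts1 => [|e es IHes] ts1 no7 /=; first by case: ts1.
have no7' : {in es, forall e, 7 \notin e} by move=> x xe; apply: no7; rewrite inE xe orbT.
case: ts1 => [[<-]|a ts1 [_]].
  by exists e, (flatten [seq 7 :: e | e <- es]); rewrite mem_head.
have {no7} : 7 \notin e by apply: no7; rewrite mem_head.
have rec ts1' : flatten [seq 7 :: e | e <- es] = ts1' ++ 7 :: ts2 ->
    exists e' rest, e' \in e :: es /\ ts2 = e' ++ rest.
  move=> /(IHes _ no7')[e' [rest [ie ->]]].
  by exists e', rest; rewrite inE ie orbT.
elim: {1 2}e ts1 => [|b f IHf] ts1 /=; first by move=> _; exact: rec.
rewrite inE negb_or => /andP[b7 f7]; case: ts1 => [[eb]|c ts1 [_]].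
  by rewrite eb in b7.
exact: IHf.
Qed.

Lemma advice_codeP (entries : seq (seq nat)) k v :
  {in entries, forall e, {in e, forall j, j < 7}} ->
  drop k (advice_code entries) = nseq 7 true ++ false :: v ->
  exists e rest, e \in entries /\ v = code e ++ rest.
Proof.
move=> small /drop_code_start[|ts1 [ts2 [/start_split h ->]]].
  move=> j /flattenP[_ /mapP[e ie ->]]; rewrite inE => /orP[/eqP->//|je].
  by apply: ltnW; exact: small je.
have [e ie|e [rest [ie ->]]] := h.
  by apply/negP => /(small e ie).
by exists e, (code rest); rewrite code_cat.
Qed.

Lemma advice_code_mem (entries : seq (seq nat)) e : e \in entries ->
  exists k rest, k <= size (advice_code entries) /\
    drop k (advice_code entries) = nseq 7 true ++ false :: code e ++ rest.
Proof.
rewrite /advice_code; elim: entries => // e' es IHes; rewrite inE => /orP[/eqP->|ie].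
  exists 0, (code (flatten [seq 7 :: e | e <- es])).
  by rewrite drop0 /= -code_cat -[code (7 :: _)]cats0 code_cons cats0.
have [k [rest [lek hk]]] := IHes ie.
exists (size (code (7 :: e')) + k), rest.
rewrite map_cons [flatten _]/= -cat_cons code_cat size_cat leq_add2l; split=> //.
by rewrite addnC -drop_drop drop_size_cat.
Qed.

(** * The OR-composition *)

Lemma iter_step_halted (M : machine) (c : config M) a b : a <= b ->
  halting (iter a (@step M) c).1 -> iter b (@step M) c = iter a (@step M) c.
Proof.
move=> leab h; rewrite -(subnK leab) iterD; elim: (b - a) => //= d ->.
by rewrite /step h.
Qed.

(** The last entry of an adjacency matrix is diagonal, hence 0: it is the bit that the machine
    pushes on its own account before the program. *)
Lemma last_allpairs_diag (T : Type) (f : T -> T -> bool) (s : seq T) :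
  (forall x, f x x = false) -> last false [seq f i j | i <- s, j <- s] = false.
Proof.
move=> irrf; case/lastP: s => // t b.
have gen d r : last d [seq f i j | i <- r, j <- rcons t b] =
    if r is [::] then d else f (last b r) b.
  elim: r d => //= a r IHr d; rewrite last_cat map_rcons last_rcons IHr.
  by case: r {IHr}.
rewrite gen last_rcons irrf; by case: (rcons t b).
Qed.

Section Reduction.
Variables (L : language) (M : machine) (chi : word -> bool) (pM pw : {poly nat}).
Hypothesis chiM : forall x, halts_within M x [:: chi x] (pM.[size x])%R.
Hypothesis LE : forall x, L x <->
  exists w : word, size w <= (pw.[size x])%R /\ chi (pair_word x w).

Definition wit_size (n : nat) : nat := (pw.[n])%R.
Definition run_time (n : nat) : nat := (pM.[n.*2.+1 + wit_size n])%R.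
(** Used with the head at position [run_time n]: the window has to reach that far to either side for
    the cone, and to contain the whole input. *)
Definition width (n : nat) : nat := run_time n + run_time n + n.*2 + wit_size n + 5.

Section FixedLength.
Variable n : nat.
Notation T := (run_time n).
Notation B0 := (width n).
Notation var := (cvar M T B0).
Notation cstr := (constraint M T B0).
Notation loc := (option (local_index M)).

Lemma width_gt : T + T < B0.+1.
Proof. by rewrite /width; lia. Qed.

(** A halted configuration stays put, so acceptance can be read at one time [T] for all witnesses;
    the output being a single bit, it is the scanned symbol. *)
Lemma language_tableau (x : word) : size x = n -> L x <->
  exists (l : 'I_(wit_size n).+1) (val : var -> bool),
    forall k : cstr, cpred T l x k [ffun q => val (cscope T k q)].
Proof.
move=> szx.
have acc w : size w <= wit_size n -> chi (pair_word x w) <->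
    scanned ((iter T (@step M) (init M (pair_word x w))).2 ord0) = Some true.
  move=> lew; have [hh ho] := chiM (pair_word x w).
  have le_t : (pM.[size (pair_word x w)])%R <= T.
    by apply: horner_nat_mono; rewrite size_pair_word szx leq_add2l.
  rewrite (iter_step_halted le_t hh); move: ho; rewrite /output.
  case: (scanned _) => [b|] //= [-> _].
  by split=> [->|[]].
have tabl (l : 'I_(wit_size n).+1) : T + (size x).*2.+1 + l < B0.+1.
  by rewrite szx /width; have := ltn_ord l; lia.
have TB := width_gt.
split=> [/LE[w [szw hw]]|[l /(@tableauP M T T B0 (leqnn _) TB l x (tabl l))[w [szw hw]]]].
  have ltw : size w < (wit_size n).+1 by rewrite ltnS /wit_size -szx.
  exists (Ordinal ltw); apply/(@tableauP M T T B0 (leqnn _) TB _ x (tabl (Ordinal ltw))).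
  by exists w; split=> //; apply/acc.
apply/LE; exists w; have lew : size w <= wit_size n by rewrite szw -ltnS.
by split; [rewrite szx|apply/acc].
Qed.

Variable t : nat.
Notation tuples := {ffun 'I_t -> n.-tuple bool}.
Notation copies := ('I_t * 'I_(wit_size n).+1)%type.

(** A tableau fixes the length of the witness, so there is one component for each pair of a word of
    the tuple and a witness length. *)
Definition or_pred (y : tuples) (j : copies) (k : cstr) (a : {ffun loc -> bool}) : bool :=
  cpred T j.2 (y j.1) k a.

Definition or_vertex : finType := csp_vertex var cstr loc copies.

Definition or_edge (y : tuples) : rel or_vertex := csp_edge (@cscope M T T B0) (or_pred y).

Definition or_param : nat :=
  #|{: core (var * csp_occ cstr loc)%type
            ((var * csp_occ cstr loc) + csp_clause cstr loc)%type}|.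

Lemma or_edge_sym y : symmetric (or_edge y).
Proof. exact: gedge_sym. Qed.

Lemma or_edge_irr y : irreflexive (or_edge y).
Proof. exact: gedge_irr. Qed.

Definition or_graph (y : tuples) : graph := graph_of (or_edge_sym y) (or_edge_irr y).

Lemma or_graphP y :
  internal_vertex_subtree (enc_graph (or_graph y)) or_param <-> exists i, L (y i).
Proof.
have k0 : cstr := inr tt.
have v0 : var := (ord0, inl (start M)).
rewrite ivst_graph_of /or_edge; split.
  case/(csp_subtreeP _ _ k0 None v0) => -[i l] [val hval]; exists i.
  by apply/(language_tableau (size_tuple _)); exists l, val.
case=> i /(language_tableau (size_tuple _))[l [val hval]].
by apply/(csp_subtreeP _ _ k0 None v0); exists (i, l), val.
Qed.

(* (i, j, b0, b1) yields b1 or b0 according to bit j of the word i. *)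
Definition tuple_spec := ('I_t * nat * bool * bool)%type.
Definition tuple_value (y : tuples) (s : tuple_spec) : bool :=
  if nth false (y s.1.1.1) s.1.1.2 then s.2 else s.1.2.
Definition spec_ok (s : tuple_spec) : Prop := s.1.1.2 < n \/ s.1.2 = s.2.

Lemma or_edge_spec (i0 : 'I_t) (u v : or_vertex) :
  exists s, spec_ok s /\ forall y, or_edge y u v = tuple_value y s.
Proof.
have [[b hb]|[[i l] [k [a hp]]]] := csp_edgeP (@cscope M T T B0) u v.
  exists (i0, 0, b, b); split=> [|y]; first by right.
  by rewrite /or_edge hb /tuple_value; case: ifP.
have [j [b0 [b1 [ok hc]]]] := @cpred_dep M T T B0 (leqnn _) width_gt n l k a.
exists (i, j, b0, b1); split=> // y.
by rewrite /or_edge hp /or_pred hc ?size_tuple.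
Qed.

Definition or_word (y : tuples) : word := enc_instance (enc_graph (or_graph y), or_param).

(** The leading 1 exists since the parameter is positive, the final 0 is a diagonal entry. Both are
    supplied by the machine through tokens 6 and 7, and only the bits between them need
    specifications. *)
Lemma or_word_specs (i0 : 'I_t) : exists specs : seq tuple_spec,
  [/\ size specs <= or_param + #|or_vertex| + #|or_vertex| * #|or_vertex|,
      {in specs, forall s, spec_ok s} &
      forall y, or_word y = true :: rcons (map (tuple_value y) specs) false].
Proof.
have [sp hsp] := choice (fun uv => or_edge_spec i0 uv.1 uv.2).
pose cst b : tuple_spec := (i0, 0, b, b).
have cstE y b : tuple_value y (cst b) = b by rewrite /tuple_value /=; case: ifP.
pose N := #|or_vertex|.
pose mat := [seq sp (enum_val a, enum_val b) | a <- enum 'I_N, b <- enum 'I_N].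
have szm : size mat = N * N by rewrite size_allpairs -cardE card_ord.
have matE y : [seq tuple_value y s | s <- mat] =
    [seq @edge (or_graph y) a b | a <- enum 'I_N, b <- enum 'I_N].
  by rewrite map_allpairs; apply: eq_allpairs => a b; rewrite -(hsp (_, _)).2.
have ok_mat : {in mat, forall s, spec_ok s}.
  by move=> _ /allpairsP[[a b] [_ _ ->]]; have [] := hsp (enum_val a, enum_val b).
have [k' ek] : exists k', or_param = k'.+1.
  exists or_param.-1; rewrite prednK //; apply/card_gt0P.
  by exists (Root _ _).
have N0 : 0 < N.
  by apply/card_gt0P; exists ((i0, ord0), Root _ _, false).
have NN0 : 0 < N * N by rewrite muln_gt0 N0.
case/lastP: mat szm matE ok_mat => [szm|mat s]; first by rewrite -szm in NN0.
rewrite size_rcons => szm matE ok_mat.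
exists (nseq k' (cst true) ++ cst false :: nseq N (cst true) ++ cst false :: mat); split.
- by rewrite !size_cat /= !size_cat /= !size_nseq ek -/N; lia.
- move=> s'; rewrite mem_cat inE mem_cat inE => /or4P[].
  + by move/nseqP => [-> _]; right.
  + by move/eqP ->; right.
  + by move/nseqP => [-> _]; right.
  + case/orP => [/eqP->|sm]; first by right.
    by apply: ok_mat; rewrite mem_rcons inE sm orbT.
- move=> y; have := matE y; rewrite map_rcons => eqm.
  have sF : tuple_value y s = false.
    rewrite -[LHS](last_rcons false (map (tuple_value y) mat)) eqm.
    by apply: last_allpairs_diag => a; exact: or_edge_irr.
  rewrite /or_word /enc_instance /enc_graph -[Defs.order _]/N -eqm sF ek.
  rewrite !(map_cat, map_nseq, map_cons) !cstE /=.
  by rewrite !rcons_cat /= rcons_cat.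
Qed.

End FixedLength.
End Reduction.

(** * Advice *)

Lemma enc_instance_inj : injective enc_instance.
Proof. by move=> [x k] [x' k'] /unary_sep_inj[/= -> ->]. Qed.

Lemma instance_of_word (w : word) : false \in w -> exists a, w = enc_instance a.
Proof.
elim: w => // b w IHw; rewrite inE; case: b => /= [/IHw[[x k] ->]|_].
  by exists (x, k.+1).
by exists (w, 0).
Qed.

Lemma size_flatten_le (S T : eqType) (F : S -> seq T) B (s : seq S) :
  {in s, forall x, size (F x) <= B} -> size (flatten (map F s)) <= size s * B.
Proof.
elim: s => //= x s IHs h; rewrite size_cat mulSn leq_add ?h ?mem_head //.
by apply: IHs => y ys; apply: h; rewrite inE ys orbT.
Qed.

Lemma size_code (ts : seq nat) :
  {in ts, forall j, j < 8} -> size (code ts) <= size ts * 8.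
Proof.
by move=> h; apply: size_flatten_le => j /h; rewrite size_cat size_nseq addn1.
Qed.

Lemma entry_small specs z : {in entry specs z, forall j, j < 7}.
Proof.
move=> j; rewrite mem_cat => /orP[/flattenP[_ /mapP[[[p b0] b1] _ ->]]|].
  rewrite mem_cat inE => /or3P[/nseqP[->]|/eqP->|/nseqP[->]] //.
  by rewrite /spec_token /=; case: (b0) (b1) => [] [].
rewrite inE mem_cat => /or3P[/eqP->|/mapP[[] _ ->]|] //.
by rewrite inE => /eqP->.
Qed.

Lemma size_entry specs z P : {in specs, forall s : bit_spec, s.1.1 <= P} ->
  size (entry specs z) <= size specs * (2 * P + 1) + size z + 2.
Proof.
move=> h; rewrite !size_cat /= size_cat size_map /= addn1 -addn2 addnA.
rewrite !leq_add2r; apply: size_flatten_le => s /h le_p.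
by rewrite size_cat /= !size_nseq; lia.
Qed.

Section Assembly.
Variables (L : language) (M : machine) (chi : word -> bool) (pM pw : {poly nat}).
Hypothesis chiM : forall x, halts_within M x [:: chi x] (pM.[size x])%R.
Hypothesis LE : forall x, L x <->
  exists w : word, size w <= (pw.[size x])%R /\ chi (pair_word x w).

Variables (K : word * nat -> word * nat) (MK : machine) (pf pK : {poly nat}).
Hypothesis KM : forall a,
  halts_within MK (enc_instance a) (enc_instance (K a)) (pK.[size (enc_instance a)])%R.
Hypothesis KE : forall a,
  [/\ internal_vertex_subtree a.1 a.2 <-> internal_vertex_subtree (K a).1 (K a).2,
      size (K a).1 <= (pf.[a.2])%R & (K a).2 <= (pf.[a.2])%R].

Definition timeK (n : nat) : nat := (pK.[n])%R.
Notation param := (or_param M pM pw).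
Definition out_size (n : nat) : nat := 2 * (pf.[param n])%R + 1.
Definition copies (n : nat) : nat := (out_size n).*2.+1.

Section FixedLength.
Variable n : nat.
Notation t := (copies n).
Notation tuples := {ffun 'I_t -> n.-tuple bool}.
Notation vertex := (or_vertex M pM pw n t).

Definition kernel_word (y : tuples) : word :=
  enc_instance (K (enc_graph (or_graph M pM pw y), param n)).

Lemma kernel_word_size y : size (kernel_word y) <= out_size n.
Proof.
rewrite /kernel_word; have := KE (enc_graph (or_graph M pM pw y), param n).
case: (K _) => x' k' /= [_ sx sk]; rewrite /enc_instance /out_size size_cat /= size_nseq.
by lia.
Qed.

Lemma kernel_word_eq y y' : kernel_word y = kernel_word y' ->
  (exists i, L (y i)) <-> exists i, L (y' i).
Proof.
move=> /enc_instance_inj e.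
have := KE (enc_graph (or_graph M pM pw y), param n).
have := KE (enc_graph (or_graph M pM pw y'), param n).
rewrite e; case: (K _) => x' k' /= [h1 _ _] [h2 _ _].
have g := or_graphP chiM LE y; have g' := or_graphP chiM LE y'.
by split=> [/g/h2/h1/g'|/g'/h1/h2/g].
Qed.

Lemma kernel_tape_word y :
  let t := kernel_tape MK timeK (or_word M pM pw y) in
  until_blank (scanned t :: right_cells t) = kernel_word y.
Proof. by have [_] := KM (enc_graph (or_graph M pM pw y), param n). Qed.

(* The word at position i is x, read from its reversed copy; the bits of the other
   words follow the first n bits of the certificate, which x hides. *)
Definition spec_pos (i : 'I_t) (s : tuple_spec t) : nat :=
  if s.1.1.2 < n then
    if s.1.1.1 == i then n - s.1.1.2.+1 else n + (s.1.1.1 * n + s.1.1.2)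
  else 0.

Definition spec_at (i : 'I_t) (s : tuple_spec t) : bit_spec :=
  (spec_pos i s, s.1.2, s.2).

(** Any [w] whatsoever describes a tuple with [x] at position [i]; soundness rests on this. *)
Definition read_tuples (i : 'I_t) (x : n.-tuple bool) (w : word) : tuples :=
  [ffun i' : 'I_t => if i' == i then x
                     else [tuple nth false w (n + (i' * n + j)) | j < n]].

Lemma spec_atE i (x : n.-tuple bool) w s : spec_ok n s ->
  spec_value (rev x) w (spec_at i s) = tuple_value (read_tuples i x w) s.
Proof.
case: s => -[[i' j] b0] b1; rewrite /spec_ok /spec_value /tuple_value /= => ok.
rewrite /spec_pos /= size_rev size_tuple ffunE.
case: (ltnP j n) ok => [ltj _|_ [//|->]]; last by rewrite !if_same.
case: (eqVneq i' i) => _ /=.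
  have -> : n - j.+1 < n by lia.
  rewrite nth_rev ?size_tuple; last by lia.
  by have -> : n - (n - j.+1).+1 = j by lia.
have -> : (n + (i' * n + j) < n) = false by lia.
have := nth_mktuple (fun j : 'I_n => nth false w (n + (i' * n + j))) false (Ordinal ltj).
by move=> /= ->.
Qed.

Definition tuple_witness (y : tuples) : word :=
  nseq n false ++ mkseq (fun q => nth false (y (inord (q %/ n))) (q %% n)) (t * n).

Lemma read_tuple_witness i (y : tuples) : read_tuples i (y i) (tuple_witness y) = y.
Proof.
apply/ffunP => i'; rewrite ffunE; case: eqP => [->//|_].
apply: eq_from_tnth => j; rewrite tnth_mktuple /tuple_witness.
have ltj := ltn_ord j; have lti := ltn_ord i'.
rewrite nth_cat size_nseq ltnNge leq_addr /= addKn nth_mkseq; last first.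
  apply: (@leq_trans (i'.+1 * n)); first by rewrite mulSn addnC ltn_add2r.
  by rewrite leq_mul2r lti orbT.
have n0 : 0 < n by exact: leq_ltn_trans (leq0n _) ltj.
rewrite divnMDl // divn_small // addn0 modnMDl modn_small //.
by rewrite (tnth_nth false) inord_val.
Qed.

(** One entry per position and chosen output. A specification takes at most 2P + 1 tokens, where P =
    n + t n bounds the positions; 3 counts the tokens 7, 6 and 2 of an entry, and 8 the bits of a
    token. *)
Definition advice_size : nat :=
  t * n.+1 * ((param n + #|vertex| + #|vertex| * #|vertex|) * (2 * (n + t * n) + 1)
              + out_size n + 3) * 8.

(** For soundness, acceptance means that the kernelization maps some tuple containing [x] to a
    listed [z]. As [z] also comes from a tuple with no word in [L], the two instances are equivalent
    and [x] is not in [L]. *)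
Lemma advice_exists : exists adv : word, size adv <= advice_size /\
  forall x : n.-tuple bool,
    (~ L x -> exists c : word, size c <= size adv + 1 + (n + t * n) /\
       sem_all MK timeK (pair_word (pair_word x adv) c) 0) /\
    (forall c, sem_all MK timeK (pair_word (pair_word x adv) c) 0 -> ~ L x).
Proof.
pose A := [set x : n.-tuple bool | `[< ~ L x >]].
have cardA : #|A| < 2 ^ n.+1.
  rewrite expnS mul2n -addnn; apply: (@leq_ltn_trans (2 ^ n)).
    by apply: leq_trans (max_card _) _; rewrite card_tuple card_bool.
  by rewrite -addn1 leq_add2l expn_gt0.
have [S [szS S1 S2]] := @distillation _ _ kernel_word kernel_word_size n.+1 A cardA.
have [specs [szspecs ok_specs or_wordE]] := or_word_specs M pM pw n (ord0 : 'I_t).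
(* Reversed, because pushing builds the instance from its last bit. *)
pose ent (iz : 'I_t * word) := entry (rev (map (spec_at iz.1) specs)) iz.2.
pose entries := [seq ent iz | iz <- [seq (i, z) | i <- enum 'I_t, z <- S]].
have mem_entries i z : z \in S -> ent (i, z) \in entries.
  by move=> zS; apply: map_f; apply/allpairsP; exists (i, z); rewrite mem_enum.
have runE i z (x : n.-tuple bool) w v tx tw : holds tx (rev x) -> holds tw w ->
    sem_emit MK timeK (code (ent (i, z)) ++ v) 0 tx tw [:: false] =
    (kernel_word (read_tuples i x w) == z).
  move=> hx hw.
  have e : map (spec_value (rev x) w) (map (spec_at i) specs) =
      map (tuple_value (read_tuples i x w)) specs.
    by rewrite -map_comp; apply/eq_in_map => s /ok_specs; exact: spec_atE.
  rewrite (@sem_emit_entry MK timeK _ z v tx tw (rev x) w _ hx hw).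
  by rewrite -kernel_tape_word or_wordE map_rev revK e cats1.
have small : {in entries, forall e, {in e, forall j, j < 7}}.
  by move=> _ /mapP[iz _ ->]; exact: entry_small.
(* The machine reads a reversed copy of the advice. *)
exists (rev (advice_code entries)); split; last move=> x.
  rewrite size_rev; apply: (leq_trans (size_code _)).
    move=> j /flattenP[_ /mapP[e ie ->]]; rewrite inE => /orP[/eqP->//|je].
    by apply: ltnW; exact: small je.
  rewrite leq_mul2r /=; set B := (X in _ * X).
  have szE : {in entries, forall e, size (7 :: e) <= B}.
    move=> _ /mapP[[i z] /allpairsP[[i' z'] [_ zS [-> ->]]] ->].
    have le_pos : {in rev (map (spec_at i') specs), forall s : bit_spec, s.1.1 <= n + t * n}.
      move=> s; rewrite mem_rev => /mapP[[[[i2 j] b0] b1] _ ->] /=.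
      rewrite /spec_pos /=; case: ifP => // ltj; case: ifP => _; first by lia.
      rewrite leq_add2l; apply: (@leq_trans (i2.+1 * n)).
        by rewrite mulSn addnC leq_add2r ltnW.
      by rewrite leq_mul2r ltn_ord orbT.
    have szz : size z' <= out_size n.
      by have [g [_ <-]] := S1 z' zS; exact: kernel_word_size.
    rewrite /=; apply: leq_ltn_trans (size_entry z' le_pos) _.
    have := leq_mul szspecs (leqnn (2 * (n + t * n) + 1)).
    rewrite size_rev size_map /B; set a := size specs * _; set b := (_ + _) * _.
    by move=> leab; rewrite addn3 addn2 !ltnS leq_add.
  apply: leq_trans (size_flatten_le szE) _; rewrite leq_mul2r; apply/orP; right.
  by rewrite size_map size_allpairs -cardE card_ord leq_mul2l szS orbT.
split=> [nLx|c /sem_all_pairP[k [w [_]]]].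
  have xA : x \in A by rewrite inE; apply/asboolP.
  have [g [i [_ gi gS]]] := S2 x xA.
  have [k [rest [lek dropE]]] := advice_code_mem (mem_entries i _ gS).
  exists (unary k ++ false :: rev (tuple_witness g)); split.
    rewrite size_cat /= size_nseq size_rev /tuple_witness size_cat size_nseq size_mkseq.
    by rewrite size_rev addnS addn1 addSn ltnS leq_add2r.
  apply/sem_all_pairP; exists k, (rev (tuple_witness g)); split=> //.
  rewrite !revK dropE sem_first_true //= (runE _ _ x (tuple_witness g)) ?eqxx //.
  - by rewrite -gi read_tuple_witness.
  - exact: holds_stack.
  - exact: holds_stack.
rewrite revK => /sem_firstP[//|v' [/(advice_codeP small)[e [rest [/mapP[[i z] + ->] ->]]]]].
case/allpairsP => -[i' z'] /= [_ zS [-> ->]].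
rewrite (runE _ _ x (rev w)); [|exact: holds_stack|exact: holds_stack].
move=> /eqP kz Lx; have [g [gA gz]] := S1 z' zS.
have [|i2 Li2] := (kernel_word_eq (etrans kz (esym gz))).1.
  by exists i'; rewrite ffunE eqxx.
by have := gA i2; rewrite inE => /asboolP.
Qed.

End FixedLength.
End Assembly.

(** * Polynomial bounds *)

Lemma poly_bounded_succ f : poly_bounded f -> poly_bounded (fun n => (f n).+1).
Proof.
move=> hf; apply: (@poly_bounded_le _ (fun n => f n + 1)) => [n|].
  by rewrite addn1.
by apply: poly_bounded_add hf _; exact: poly_bounded_const.
Qed.

Lemma poly_bounded_double f : poly_bounded f -> poly_bounded (fun n => (f n).*2).
Proof.
move=> hf; apply: (@poly_bounded_le _ (fun n => f n + f n)) => [n|].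
  by rewrite addnn.
exact: poly_bounded_add.
Qed.

Ltac solve_poly_bounded := repeat first
  [ assumption | exact: poly_bounded_id | exact: poly_bounded_const
  | apply: poly_bounded_succ | apply: poly_bounded_double
  | apply: poly_bounded_add | apply: poly_bounded_mul | apply: poly_bounded_horner ].

Section Bounds.
Variables (M : machine) (pM pw : {poly nat}).

Lemma wit_size_bounded : poly_bounded (wit_size pw).
Proof. by exists pw. Qed.

Lemma run_time_bounded : poly_bounded (run_time pM pw).
Proof. have h := wit_size_bounded; rewrite /run_time; solve_poly_bounded. Qed.

Lemma width_bounded : poly_bounded (width pM pw).
Proof.
have h := wit_size_bounded; have h' := run_time_bounded; rewrite /width; solve_poly_bounded.
Qed.

Lemma card_core_bounded (X C : nat -> finType) :
  poly_bounded (fun n => #|X n|) -> poly_bounded (fun n => #|C n|) ->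
  poly_bounded (fun n => #|{: core (X n) (C n)}|).
Proof.
by move=> hX hC; apply: poly_bounded_le (fun n => card_core (X n) (C n)) _; solve_poly_bounded.
Qed.

Lemma card_prod_bounded (X Y : nat -> finType) :
  poly_bounded (fun n => #|X n|) -> poly_bounded (fun n => #|Y n|) ->
  poly_bounded (fun n => #|{: X n * Y n}|).
Proof.
move=> hX hY; apply: (@poly_bounded_le _ (fun n => #|X n| * #|Y n|)); last solve_poly_bounded.
by move=> n; rewrite card_prod.
Qed.

Lemma card_sum_bounded (X Y : nat -> finType) :
  poly_bounded (fun n => #|X n|) -> poly_bounded (fun n => #|Y n|) ->
  poly_bounded (fun n => #|{: X n + Y n}|).
Proof.
move=> hX hY; apply: (@poly_bounded_le _ (fun n => #|X n| + #|Y n|)); last solve_poly_bounded.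
by move=> n; rewrite card_sum.
Qed.

Lemma card_ord_bounded f : poly_bounded f -> poly_bounded (fun n => #|{: 'I_(f n)}|).
Proof. by apply: poly_bounded_le => n; rewrite card_ord. Qed.

Ltac card_bounded := repeat first
  [ apply: poly_bounded_const | apply: card_core_bounded | apply: card_prod_bounded
  | apply: card_sum_bounded | apply: card_ord_bounded ].

Lemma or_param_bounded : poly_bounded (or_param M pM pw).
Proof.
have h := run_time_bounded; have h' := width_bounded.
rewrite /or_param; card_bounded; solve_poly_bounded.
Qed.

Lemma or_vertex_bounded (t : nat -> nat) : poly_bounded t ->
  poly_bounded (fun n => #|or_vertex M pM pw n (t n)|).
Proof.
have h := run_time_bounded; have h' := width_bounded; have h'' := wit_size_bounded.
move=> ht; rewrite /or_vertex; card_bounded; solve_poly_bounded.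
Qed.

Variable pf : {poly nat}.

Lemma copies_bounded : poly_bounded (copies M pM pw pf).
Proof. have h := or_param_bounded; rewrite /copies /out_size; solve_poly_bounded. Qed.

Lemma advice_size_bounded : poly_bounded (advice_size M pM pw pf).
Proof.
have h := or_param_bounded; have h' := copies_bounded.
have h'' := or_vertex_bounded h'.
rewrite /advice_size /out_size; solve_poly_bounded.
Qed.

End Bounds.

(** * Membership in coNP/poly *)

Lemma sem_all_polytime (MK : machine) (pK : {poly nat}) :
  (forall w : word, false \in w ->
     halting (iter (pK.[size w])%R (@step MK) (init MK w)).1) ->
  polytime enc_word enc_bool (fun v => sem_all MK (timeK pK) v 0).
Proof.
move=> haltK; exists (interp MK), ('X + ('X + pK + 4%:P) + 6%:P)%R => v.
rewrite !hornerD !hornerX !hornerC.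
apply: (@interp_halts MK (timeK pK) _ _ _ v (leqnn _)) => //.
by move=> a b; exact: horner_nat_mono.
Qed.

Theorem theorem3 :
  ~ class_incl class_NP (class_poly (class_co class_NP)) ->
  ~ has_polynomial_kernel internal_vertex_subtree.
Proof.
move=> nincl [K [f [[[MK [pK KM]] _ KE] [pf fE]]]]; apply: nincl.
move=> L [R [pw [[chi [chiP RE] LE]]]].
case: chiP => M [pM chiM].
have LE' x : L x <-> exists w : word, size w <= (pw.[size x])%R /\ chi (pair_word x w).
  rewrite LE; split=> -[w [szw /RE hw]]; exists w; split=> //; exact/RE.
have KE' a : [/\ internal_vertex_subtree a.1 a.2 <->
      internal_vertex_subtree (K a).1 (K a).2,
    size (K a).1 <= (pf.[a.2])%R & (K a).2 <= (pf.[a.2])%R].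
  by case: a => x k /=; have := KE x k; case: (K _) => x' k'; rewrite fE.
have haltK (w : word) : false \in w ->
    halting (iter (pK.[size w])%R (@step MK) (init MK w)).1.
  by move=> /instance_of_word[a ->]; have [] := KM a.
have [adv advP] := choice (@advice_exists L M chi pM pw chiM LE' K MK pf pK KM KE').
have [pt ptE] := copies_bounded M pM pw pf.
have [pa paE] := advice_size_bounded M pM pw pf.
(* Room for a certificate: at most |adv| + 1 bits for the entry point and n + t n for the tuple,
   where n and |adv| are at most the length of the pair. *)
pose q : {poly nat} := ('X + 1%:P + ('X + pt * 'X))%R.
pose accepts v := exists c : word, size c <= (q.[size v])%R /\
  sem_all MK (timeK pK) (pair_word v c) 0.
(* Certificates witness non-membership in [L], so [L] itself is decided by the complement of the NP
   language [accepts]. *)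
exists (fun v => ~ accepts v), adv, pa; split.
- exists (fun v => sem_all MK (timeK pK) v 0), q; split.
    by exists (fun v => sem_all MK (timeK pK) v 0); split=> //; exact: sem_all_polytime.
  by move=> v; split=> [/contrapT|acc nacc].
- by move=> n; have [h _] := advP n; exact: leq_trans (paE n).
- move=> x; have [_ /(_ (in_tuple x)) [/= complete sound]] := advP (size x).
  split=> [Lx [c [_ /sound]] //|nacc]; apply: contrapT => nLx; apply: nacc.
  have [c [szc acc]] := complete nLx; exists c; split=> //; apply: leq_trans szc _.
  rewrite /q !hornerD hornerM !hornerX !hornerC size_pair_word.
  have le_t : copies M pM pw pf (size x) <= (pt.[(size x).*2.+1 + size (adv (size x))])%R.
    by apply: leq_trans (ptE _) _; apply: horner_nat_mono; lia.
  apply: leq_add; first by rewrite leq_add2r leq_addl.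
  by apply: leq_add; [|apply: leq_mul => //]; lia.
Qed.
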